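(* Consider the control problem with cost $J(\pi,\rho)$ described in the context, and let a policy $\pi=\{\pi_k\}_{k=0}^{T-1}$ be given with $\pi_k(\cdot\mid x)=\mathcal{N}(P_kx+q_k,\Sigma_{\pi_k})$, where $P_k\in\mathbb{R}^{m\times n}$, $q_k\in\mathbb{R}^m$, $\Sigma_{\pi_k}\in\mathbb{R}^{m\times m}$, $\Sigma_{\pi_k}\succ0$. Let $\mu_{x_k}$ and $\Sigma_{x_k}$ be the mean and covariance matrix of the state $x_k$ under $\pi$, i.e. for $k\in\{0,\dots,T-1\}$, $$\mu_{x_{k+1}}=(A_k+B_kP_k)\mu_{x_k}+B_kq_k,\qquad \mu_{x_0}=\mu_{x_{\mathrm{ini}}},$$ $$\Sigma_{x_{k+1}}=(A_k+B_kP_k)\Sigma_{x_k}(A_k+B_kP_k)^\top+B_k\Sigma_{\pi_k}B_k^\top+\Sigma_{w_k},\qquad \Sigma_{x_0}=\Sigma_{x_{\mathrm{ini}}}.$$ Then the minimization of $\rho\mapsto J(\pi,\rho)$ over all priors $\rho=\{\rho_k\}_{k=0}^{T-1}$, with the policy fixed to the given $\pi$, has a unique optimal prior $\rho^\pi=\{\rho_k^\pi\}_{k=0}^{T-1}$, and it is given by $$\rho_k^\pi=\mathcal{N}\left(P_k\mu_{x_k}+q_k,\ \Sigma_{\pi_k}+P_k\Sigma_{x_k}P_k^\top\right),\quad k\in\{0,\dots,T-1\}.$$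
   Context: Setting. $\varepsilon>0$; $T\ge1$, $n,m\ge 1$ are integers; $\mu_{x_{\mathrm{ini}}},\mu_{x_{\mathrm{fin}}}\in\mathbb{R}^n$; $A_k\in\mathbb{R}^{n\times n}$, $B_k\in\mathbb{R}^{n\times m}$; $R_k\in\mathbb{R}^{m\times m}$, $F,\Sigma_{w_k},\Sigma_{x_{\mathrm{ini}}}\in\mathbb{R}^{n\times n}$ are all symmetric positive definite ($\succ0$), for $k\in\{0,\dots,T-1\}$. A (stochastic) policy is a family $\pi=\{\pi_k\}_{k=0}^{T-1}$, where $\pi_k(\cdot\mid x)$ is a conditional probability distribution (Markov kernel) on $\mathbb{R}^m$ given $x\in\mathbb{R}^n$. A prior is a family $\rho=\{\rho_k\}_{k=0}^{T-1}$ of probability distributions on $\mathbb{R}^m$. Under a policy $\pi$, the state $x_k\in\mathbb{R}^n$ and input $u_k\in\mathbb{R}^m$ evolve by $$x_{k+1}=A_kx_k+B_ku_k+w_k,\quad u_k\sim\pi_k(\cdot\mid x)\text{ given }x=x_k,\quad w_k\sim\mathcal{N}(0,\Sigma_{w_k}),\quad x_0\sim\mathcal{N}(\mu_{x_{\mathrm{ini}}},\Sigma_{x_{\mathrm{ini}}}),$$ where, for each $k$, the conditional law of $u_k$ given the whole past $(x_0,u_0,w_0,\dots,u_{k-1},w_{k-1},x_k)$ is $\pi_k(\cdot\mid x_k)$, and $w_k$ is independent of $(x_0,u_0,w_0,\dots,u_{k-1},w_{k-1},x_k,u_k)$. The cost is $$J(\pi,\rho):=\mathbb{E}\left[\sum_{k=0}^{T-1}\left\{\tfrac12\|u_k\|_{R_k}^2+\varepsilon\,\mathcal{D}_{\mathrm{KL}}[\pi_k(\cdot\mid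 x_k)\,\|\,\rho_k(\cdot)]\right\}+\tfrac12\|x_T-\mu_{x_{\mathrm{fin}}}\|_F^2\right],$$ with values in $[0,\infty]$, where $\|v\|_M:=(v^\top Mv)^{1/2}$ and $\mathcal{D}_{\mathrm{KL}}[p\|q]$ is the Kullback–Leibler divergence ($+\infty$ if $p$ is not absolutely continuous with respect to $q$). $\mathcal{N}(\mu,\Sigma)$ is the Gaussian distribution with mean $\mu$ and covariance $\Sigma$. *)

(* Defs.v *)
(* Built on MathComp and MathComp-Analysis. *)
From HB Require Import structures.
From mathcomp Require Export all_boot all_order all_algebra.
From mathcomp Require Export all_classical all_reals all_analysis.

Set Implicit Arguments.
Unset Strict Implicit.
Unset Printing Implicit Defensive.

Export Order.TTheory GRing.Theory Num.Theory.
Export numFieldNormedType.Exports.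

Global Open Scope classical_set_scope.
Global Open Scope ring_scope.

(* The sigma-algebra of column vectors is generated by the coordinates (as the
   library does for n.-tuple); it is the Borel sigma-algebra of R^n. *)
Definition colvec_display : measure_display.
Proof. exact: default_measure_display. Qed.

Section measurable_colvec.
Context {R : realType} (n : nat).

Definition colvec_coord (i : 'I_n) (x : 'cV[R]_n) : R := x i 0.

Let colvec_set0 : g_sigma_preimage colvec_coord set0.
Proof. exact: sigma_algebra0. Qed.

Let colvec_setC A :
  g_sigma_preimage colvec_coord A -> g_sigma_preimage colvec_coord (~` A).
Proof. exact: sigma_algebraC. Qed.

Let colvec_bigcup (F : (set 'cV[R]_n)^nat) :
  (forall i, g_sigma_preimage colvec_coord (F i)) ->
  g_sigma_preimage colvec_coord (\bigcup_i F i).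
Proof. exact: sigma_algebra_bigcup. Qed.

HB.instance Definition _ := @isMeasurable.Build colvec_display
  'cV[R]_n (g_sigma_preimage colvec_coord)
  colvec_set0 colvec_setC colvec_bigcup.

Lemma measurable_colvec_coord (i : 'I_n) :
  measurable_fun [set: 'cV[R]_n] (colvec_coord i).
Proof.
move=> _ Y mY; rewrite setTI; apply: sub_sigma_algebra => /=.
rewrite -bigcup_seq/=; exists i => /=; first by rewrite mem_index_enum.
by exists Y => //; rewrite setTI.
Qed.

Lemma measurable_fun_colvecP d (S : measurableType d) (f : S -> 'cV[R]_n) :
  measurable_fun [set: S] f <->
  forall i, measurable_fun [set: S] (fun s => f s i 0).
Proof.
split=> [mf i|mf].
  exact: measurableT_comp (measurable_colvec_coord i) mf.
suff : g_sigma_preimage (fun i => colvec_coord i \o f) `<=` measurable.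
  rewrite g_sigma_preimage_comp => h _ A mA.
  by apply: h; exists A.
apply: smallest_sub; first exact: sigma_algebra_measurable.
rewrite -bigcup_seq => A [i _ [B mB <-]].
exact: mf.
Qed.

End measurable_colvec.

Section lebesgue_colvec.
Context {R : realType}.

Definition colvec_cons n (z : measurableTypeR R * 'cV[R]_n) : 'cV[R]_n.+1 :=
  col_mx (z.1)%:M z.2.

Lemma colvec_cons0 n z : @colvec_cons n z 0 0 = z.1.
Proof.
have -> : (0 : 'I_n.+1) = lshift n (0 : 'I_1) by apply/val_inj.
by rewrite /colvec_cons (@col_mxEu _ 1) mxE eqxx mulr1n.
Qed.

Lemma colvec_consS n z (i : 'I_n) : colvec_cons z (lift 0 i) 0 = z.2 i 0.
Proof.
have -> : lift 0 i = rshift 1 i by apply/val_inj.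
by rewrite /colvec_cons (@col_mxEd _ 1).
Qed.

Lemma measurable_colvec_cons n : measurable_fun setT (@colvec_cons n).
Proof.
apply/measurable_fun_colvecP => i; case: (unliftP 0 i) => [j|] ->.
  rewrite (_ : (fun _ => _) = colvec_coord j \o snd); last first.
    by apply/funext => z; rewrite /= colvec_consS.
  exact: measurableT_comp (measurable_colvec_coord j) measurable_snd.
rewrite (_ : (fun _ => _) = fst); first exact: measurable_fst.
by apply/funext => z; rewrite /= colvec_cons0.
Qed.

Section step.
Variables (n : nat) (nu : {sigma_finite_measure set 'cV[R]_n -> \bar R}).

Definition lebesgue_colvecS : set 'cV[R]_n.+1 -> \bar R :=
  pushforward (lebesgue_measure \x nu)%E (@colvec_cons n).

Let lebesgue_colvecS0 : lebesgue_colvecS set0 = 0%E.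
Proof. by rewrite /lebesgue_colvecS /pushforward preimage_set0 measure0. Qed.

Let lebesgue_colvecS_ge0 A : (0 <= lebesgue_colvecS A)%E.
Proof. by rewrite /lebesgue_colvecS /pushforward. Qed.

Let lebesgue_colvecS_sigma_additive : semi_sigma_additive lebesgue_colvecS.
Proof.
have mpre B : measurable B -> measurable (@colvec_cons n @^-1` B).
  by move=> mB; rewrite -[X in measurable X]setTI; exact: measurable_colvec_cons.
move=> F mF tF mUF; rewrite /lebesgue_colvecS /pushforward preimage_bigcup.
apply: measure_semi_sigma_additive.
- by move=> k; exact: mpre.
- apply/trivIsetP => /= i j _ _ ij; rewrite -preimage_setI.
  by move/trivIsetP : tF => /(_ _ _ _ _ ij) ->//; rewrite preimage_set0.
- by rewrite -preimage_bigcup; exact: mpre.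
Qed.

HB.instance Definition _ := isMeasure.Build _ _ _ lebesgue_colvecS
  lebesgue_colvecS0 lebesgue_colvecS_ge0 lebesgue_colvecS_sigma_additive.

Let lebesgue_colvecS_sigma_finite : sigma_finite setT lebesgue_colvecS.
Proof.
pose uncons (x : 'cV[R]_n.+1) : measurableTypeR R * 'cV[R]_n :=
  (x 0 0, \col_i x (lift 0 i) 0).
have consK : cancel (@colvec_cons n) uncons.
  move=> z; rewrite [RHS]surjective_pairing /uncons colvec_cons0; congr pair.
  by apply/matrixP => i j; rewrite mxE colvec_consS ord1.
have muncons : measurable_fun setT uncons.
  apply/measurable_fun_pairP; split=> /=.
    exact: (@measurable_colvec_coord R n.+1 0).
  apply/measurable_fun_colvecP => i.
  rewrite (_ : (fun _ => _) = @colvec_coord R n.+1 (lift 0 i)).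
    exact: measurable_colvec_coord.
  by apply/funext => x /=; rewrite mxE.
have /sigma_finiteP[F [TF ndF Foo]] :=
  sigma_finiteT (lebesgue_measure : {sigma_finite_measure set _ -> \bar R}).
have /sigma_finiteP[G [TG ndG Goo]] := sigma_finiteT nu.
exists (fun k => uncons @^-1` (F k `*` G k)).
  rewrite -preimage_bigcup (_ : \bigcup_k _ = setT) ?preimage_setT//.
  rewrite -subTset => -[x y] _.
  have [i _ Fix] : (\bigcup_k F k) x by rewrite -TF.
  have [j _ Gjy] : (\bigcup_k G k) y by rewrite -TG.
  exists (maxn i j) => //; split => /=.
  - by move: x Fix; exact/subsetPset/ndF/leq_maxl.
  - by move: y Gjy; exact/subsetPset/ndG/leq_maxr.
move=> k; have [mFk Fkoo] := Foo k; have [mGk Gkoo] := Goo k; split.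
  by rewrite -[X in measurable X]setTI; apply: muncons => //; exact: measurableX.
rewrite /lebesgue_colvecS /pushforward -comp_preimage.
rewrite (_ : uncons \o _ = id); last by apply/funext => z /=; exact: consK.
rewrite preimage_id product_measure1E//.
by rewrite lte_mul_pinfty// ge0_fin_numE.
Qed.

HB.instance Definition _ := Measure_isSigmaFinite.Build _ _ _ lebesgue_colvecS
  lebesgue_colvecS_sigma_finite.

End step.

(* n-fold product of the one-dimensional Lebesgue measure *)
Fixpoint lebesgue_colvec n : {sigma_finite_measure set 'cV[R]_n -> \bar R} :=
  if n is n'.+1 then lebesgue_colvecS (lebesgue_colvec n') else \d_(0 : 'cV[R]_0).

End lebesgue_colvec.

Definition same_law d (S : measurableType d) (R : realType)
    (p q : set S -> \bar R) : Prop :=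
  forall A, measurable A -> p A = q A.

Section gaussian.
Context {R : realType}.

Definition posdefmx n (M : 'M[R]_n) : Prop :=
  M^T = M /\ forall v : 'cV[R]_n, v != 0 -> 0 < (v^T *m M *m v) 0 0.

Definition wnorm n (M : 'M[R]_n) (v : 'cV[R]_n) : R :=
  Num.sqrt ((v^T *m M *m v) 0 0).

Definition gaussian_pdf n (mu : 'cV[R]_n) (Sigma : 'M[R]_n) (x : 'cV[R]_n) : R :=
  (Num.sqrt ((2 * pi) ^+ n * \det Sigma))^-1 *
  expR (- (2^-1 * ((x - mu)^T *m invmx Sigma *m (x - mu)) 0 0)).

(* N(mu, Sigma); meaningful when Sigma is positive definite. *)
Definition gaussian n (mu : 'cV[R]_n) (Sigma : 'M[R]_n) (A : set 'cV[R]_n) : \bar R :=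
  (\int[lebesgue_colvec n]_(x in A) (gaussian_pdf mu Sigma x)%:E)%E.

End gaussian.

Section kullback_leibler.
Context d (S : measurableType d) (R : realType).
Local Open Scope ereal_scope.

(* The integral of log (dp/dq) is taken against p, so the values of the
   Radon-Nikodym derivative where it is <= 0 (and lne is -oo) are irrelevant. *)
Definition KL (p q : probability S R) : \bar R :=
  if `[< p `<< q >]
  then \int[p]_x lne (Radon_Nikodym (charge_of_finite_measure p) q x)
  else +oo.

End kullback_leibler.

(* The value k(. | x) of a Markov kernel, with its probability structure. *)
Section pker_at.
Context d d' (X : measurableType d) (Y : measurableType d') (R : realType).
Variables (k : R.-pker X ~> Y) (x : X).

Definition pker_at : set Y -> \bar R := k x.

HB.instance Definition _ := Measure.on pker_at.

Let pker_at_setT : pker_at setT = 1%E.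
Proof. exact: prob_kernel. Qed.

HB.instance Definition _ := Measure_isProbability.Build _ _ _ pker_at pker_at_setT.
End pker_at.

Section control.
Context {R : realType} (T n m : nat).
Variables (eps : R) (mu_ini mu_fin : 'cV[R]_n) (Sigma_ini : 'M[R]_n).
Variables (A : 'I_T -> 'M[R]_n) (B : 'I_T -> 'M[R]_(n, m)).
Variables (Rc : 'I_T -> 'M[R]_m) (F : 'M[R]_n) (Sigma_w : 'I_T -> 'M[R]_n).
Context d (Omega : measurableType d) (Pr : probability Omega R).
(* Only x_0, ..., x_T enter the equations and the cost. *)
Variables (x : nat -> {RV Pr >-> 'cV[R]_n}).
Variables (u : 'I_T -> {RV Pr >-> 'cV[R]_m}) (w : 'I_T -> {RV Pr >-> 'cV[R]_n}).
Variable pi : 'I_T -> R.-pker 'cV[R]_n ~> 'cV[R]_m.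

Local Notation sigma_of f := (preimage_set_system setT f measurable).

(* Generators of the sigma-algebra of (x_0, u_0, w_0, ..., u_(k-1), w_(k-1), x_k). *)
Definition past (k : 'I_T) : set (set Omega) :=
  sigma_of (x 0%N) `|` sigma_of (x k) `|`
  \bigcup_(j in [set j : 'I_T | (j < k)%N]) (sigma_of (u j) `|` sigma_of (w j)).

Record closed_loop : Prop := ClosedLoop {
  closed_loop_init : same_law (distribution Pr (x 0%N)) (gaussian mu_ini Sigma_ini);
  closed_loop_step : forall (k : 'I_T) om,
    x k.+1 om = A k *m x k om + B k *m u k om + w k om;
  (* the conditional law of u_k given the past is pi_k(. | x_k) *)
  closed_loop_input : forall (k : 'I_T) E D,
    <<s past k >> E -> measurable D ->
    Pr (E `&` u k @^-1` D) = (\int[Pr]_(om in E) pi k (x k om) D)%E;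
  closed_loop_noise : forall k : 'I_T,
    same_law (distribution Pr (w k)) (gaussian 0 (Sigma_w k));
  (* w_k is independent of the past and u_k *)
  closed_loop_indep : forall (k : 'I_T) E D,
    <<s past k `|` sigma_of (u k) >> E -> measurable D ->
    Pr (E `&` w k @^-1` D) = (Pr E * Pr (w k @^-1` D))%E }.

Definition cost (rho : 'I_T -> probability 'cV[R]_m R) : \bar R :=
  (\int[Pr]_om
     (\sum_(k < T) ((2^-1 * wnorm (Rc k) (u k om) ^+ 2)%:E
                    + eps%:E * KL (pker_at (pi k) (x k om)) (rho k))
      + (2^-1 * wnorm F (x T om - mu_fin) ^+ 2)%:E))%E.

Definition optimal_prior (rho : 'I_T -> probability 'cV[R]_m R) : Prop :=
  forall rho', (cost rho <= cost rho')%E.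

End control.

(* Main.v *)
From HB Require Import structures.
Require Import Defs.
From mathcomp Require Import measurable_realfun ring lra.

(* For a fixed policy only the KL terms of the cost depend on the prior.  If r is the
   law of u_k and r = f q, then integrating
     log (d pi_k(.|x) / d q) = log (d pi_k(.|x) / d r) + log f
   against the joint law of (x_k, u_k) gives
     E KL(pi_k(.|x_k) || q) = E KL(pi_k(.|x_k) || r) + KL(r || q),
   so r is the unique minimizer as soon as E KL(pi_k(.|x_k) || r) is finite.  To avoid
   undefined differences of infinities, log f is traded for 1 - 1/f and the
   nonnegative gap log f - 1 + 1/f.  That r is the announced Gaussian follows from
   completing the square, all normalizing constants being obtained by induction on
   the dimension through Schur complements. *)

Set Implicit Arguments.
Unset Strict Implicit.
Unset Printing Implicit Defensive.

(** * Densities and relative entropy *)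

(** With s = 1/f and d = log f - 1 + 1/f, the chain rule for a single p = pi_k(.|x) reads KL(p||q) +
    int s dp = KL(p||r) + 1 + int d dp. No term is negative, so it can be averaged in [0, +oo]. For
    one x the integral of s may be infinite, but s <= 2 d + 2 makes that of d infinite as well, and
    the identity persists. Averaging replaces p by r in the integrals of s and d, and int s dr = q(f
    > 0) <= 1; this bound gives minimality. In the case of equality, int s dr = 1 + int d dr forces
    int d dr = 0. Since d vanishes only at f = 1, this yields r <= q on every event, hence q = r. A
    prior that does not dominate r is never competitive: the policy has an everywhere positive
    density, so each KL(pi_k(.|x)||q) is then +oo. Uniqueness cancels the terms common to two costs,
    so these must be finite; hence the second moment estimates. On the Gaussian side, A x + B u may
    have no density, and it is the noise that supplies one for the next state. *)

Definition has_density d (S : measurableType d) (R : realType)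
    (nu mu : set S -> \bar R) (g : S -> R) : Prop :=
  forall A, measurable A -> nu A = (\int[mu]_(x in A) (g x)%:E)%E.

Lemma measurable_lne (R : realType) : measurable_fun setT (@lne R).
Proof.
have -> : @lne R = fun x => if (x == +oo)%E then +oo%E
    else if (x <= 0)%E then -oo%E else (ln (fine x))%:E.
  apply/funext => -[r| |]; rewrite ?eqxx ?leNye//=.
apply: measurable_fun_ifT; [exact: measurable_fun_eqe| |] => //.
apply: measurable_fun_ifT; [exact: measurable_fun_lee| |] => //.
apply/measurable_EFinP/measurableT_comp; [exact: measurable_ln|].
exact: fine_measurable.
Qed.

Section density.
Local Open Scope ereal_scope.
Context d (S : measurableType d) (R : realType).

Lemma integral_probability_cst (p : probability S R) (c : \bar R) :
  \int[p]_x c = c.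
Proof.
rewrite integral_cst// -[RHS]mule1; congr (_ * _); exact: probability_setT.
Qed.

(** The change of variables holds for the Radon-Nikodym derivative of [nu]. Two functions with the
    same integral over every measurable set agree [mu]-a.e., so [g] can take its place. *)
Lemma ge0_integral_density (nu : {finite_measure set S -> \bar R})
    (mu : {sigma_finite_measure set S -> \bar R}) (g : S -> R) :
  measurable_fun setT g -> (forall x, (0 <= g x)%R) -> has_density nu mu g ->
  forall f : S -> \bar R, measurable_fun setT f -> (forall x, 0 <= f x) ->
  \int[nu]_x f x = \int[mu]_x (f x * (g x)%:E).
Proof.
move=> mg g0 nug f mf f0.
have mgE : measurable_fun setT (EFin \o g) by exact/measurable_EFinP.
have numu : nu `<< mu.
  apply/null_content_dominatesP => A mA muA.
  rewrite nug// null_set_integral//; exact: measurable_funTS.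
rewrite -(Radon_Nikodym_SigmaFinite.change_of_variables numu)//.
have rni := Radon_Nikodym_SigmaFinite.f_integrable numu.
have mrn := measurable_int _ rni.
apply: ae_eq_integral => //; [exact: emeasurable_funM|exact: emeasurable_funM|].
apply: ae_eqe_mul2l; apply: integral_ae_eq => // E _ mE.
by rewrite -Radon_Nikodym_SigmaFinite.f_integral// nug.
Qed.

Lemma integral_density (nu : {finite_measure set S -> \bar R})
    (mu : {sigma_finite_measure set S -> \bar R}) (g : S -> R) :
  measurable_fun setT g -> (forall x, (0 <= g x)%R) -> has_density nu mu g ->
  forall f : S -> \bar R, measurable_fun setT f ->
  \int[nu]_x f x = \int[mu]_x (f x * (g x)%:E).
Proof.
move=> mg g0 nug f mf; rewrite [LHS]integralE [RHS]integralE.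
rewrite !(ge0_integral_density mg g0 nug)//; last 2 first.
  exact: measurable_funeneg.
  exact: measurable_funepos.
congr (_ - _); apply: eq_integral => x _.
  by rewrite !funeposE maxe_pMl// ?mul0e// lee_fin.
by rewrite !funenegE maxe_pMl// ?mul0e ?muleN ?mulNe// lee_fin.
Qed.

Lemma ge0_integral_density_in (nu : {finite_measure set S -> \bar R})
    (mu : {sigma_finite_measure set S -> \bar R}) (g : S -> R) :
  measurable_fun setT g -> (forall x, (0 <= g x)%R) -> has_density nu mu g ->
  forall (A : set S) (f : S -> \bar R), measurable A ->
  measurable_fun setT f -> (forall x, 0 <= f x) ->
  \int[nu]_(x in A) f x = \int[mu]_(x in A) (f x * (g x)%:E).
Proof.
move=> mg g0 nug A f mA mf f0; rewrite integral_mkcond [RHS]integral_mkcond.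
rewrite (ge0_integral_density mg g0 nug).
- by apply: eq_integral => x _; rewrite !patchE; case: ifP; rewrite ?mul0e.
- by apply/(measurable_restrictT _ mA); exact: measurable_funTS.
- by move=> x; rewrite patchE; case: ifP.
Qed.

Lemma density_null_dominates (nu : {measure set S -> \bar R})
    (mu : {measure set S -> \bar R}) (g : S -> R) :
  measurable_fun setT g -> has_density nu mu g -> nu `<< mu.
Proof.
move=> mg nug; apply/null_content_dominatesP => A mA muA.
rewrite nug// null_set_integral//; apply: measurable_funTS.
exact/measurable_EFinP.
Qed.

Lemma gt0_density_null_dominates (nu mu : {measure set S -> \bar R}) (g : S -> R) :
  measurable_fun setT g -> (forall x, (0 < g x)%R) -> has_density nu mu g ->
  mu `<< nu.
Proof.
move=> mg g0 nug; apply/null_content_dominatesP => A mA nuA0.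
have int0 : \int[mu]_(x in A) (g x)%:E = 0 := etrans (esym (nug A mA)) nuA0.
have mgA : measurable_fun A (EFin \o g).
  by apply: measurable_funTS; exact/measurable_EFinP.
have : ae_eq mu A (EFin \o g) (cst 0).
  apply/ae_eq_integral_abs => //; rewrite -[RHS]int0; apply: eq_integral => x _ /=.
  by rewrite ger0_norm// ltW.
move=> [N [mN N0 sub]]; apply: (subset_measure0 mA mN) => // x Ax.
apply: sub => /= /(_ Ax) [gx0]; have := g0 x.
by rewrite gx0 ltxx.
Qed.

Lemma has_densityM (p : {measure set S -> \bar R}) (r : {finite_measure set S -> \bar R})
    (mu : {sigma_finite_measure set S -> \bar R}) (h f : S -> R) :
  measurable_fun setT h -> (forall x, (0 <= h x)%R) ->
  measurable_fun setT f -> (forall x, (0 <= f x)%R) ->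
  has_density p r h -> has_density r mu f ->
  has_density p mu (fun x => h x * f x)%R.
Proof.
move=> mh h0 mf f0 pr rmu A mA; rewrite pr//.
rewrite (ge0_integral_density_in mf f0 rmu)//; last exact/measurable_EFinP.
Qed.

(** The quotient rule for densities. The factor 1/f is spelled [expR (- ln (f x))] so that it merges
    with [h] into the exponential of a log-ratio. *)
Lemma has_density_div (p : {measure set S -> \bar R}) (r : {finite_measure set S -> \bar R})
    (mu : {sigma_finite_measure set S -> \bar R}) (h f : S -> R) :
  measurable_fun setT h -> (forall x, (0 <= h x)%R) ->
  measurable_fun setT f -> (forall x, (0 < f x)%R) ->
  has_density p mu h -> has_density r mu f ->
  has_density p r (fun x => h x * expR (- ln (f x)))%R.
Proof.
move=> mh h0 mf f0 pmu rmu A mA; rewrite pmu//.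
have f0' x : (0 <= f x)%R by rewrite ltW.
rewrite (ge0_integral_density_in mf f0' rmu)//.
- apply: eq_integral => x _; rewrite -EFinM expRN lnK ?divfK ?gt_eqF//.
  by rewrite posrE.
- apply/measurable_EFinP; apply: measurable_funM => //.
  apply: measurableT_comp => //; apply: measurableT_comp => //.
  exact: measurableT_comp.
- by move=> x; rewrite lee_fin mulr_ge0// expR_ge0.
Qed.

Lemma ae_density_gt0 (p q : {measure set S -> \bar R}) (f : S -> R) :
  measurable_fun setT f -> (forall x, (0 <= f x)%R) -> has_density p q f ->
  {ae p, forall x, (0 < f x)%R}.
Proof.
move=> mf f0 pq; exists [set x | (f x <= 0)%R]; split.
- rewrite -[X in measurable X]setTI; apply: measurable_fun_le => //.
- rewrite pq; last first.
    by rewrite -[X in measurable X]setTI; apply: measurable_fun_le.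
  rewrite integral0_eq// => x /= fx0; congr EFin; apply/le_anti.
  by rewrite fx0 f0.
- by move=> x /= /negP; rewrite -leNgt.
Qed.

(** [f] agrees with the Radon-Nikodym derivative [q]-a.e., hence [p]-a.e. by domination. Moreover
    [f] is positive [p]-a.e., which is where [lne] and [ln] coincide. *)
Lemma KL_density (p q : probability S R) (f : S -> R) :
  measurable_fun setT f -> (forall x, (0 <= f x)%R) -> has_density p q f ->
  KL p q = \int[p]_x (ln (f x))%:E.
Proof.
move=> mf f0 pq.
have pllq : p `<< q := density_null_dominates mf pq.
rewrite /KL ifT; last exact/asboolP.
set g := Radon_Nikodym _ _.
have gi : q.-integrable setT g by exact: Radon_Nikodym_integrable.
have mg : measurable_fun setT g := measurable_int _ gi.
have gf : ae_eq q setT g (EFin \o f).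
  apply: integral_ae_eq => //; first exact/measurable_EFinP.
  by move=> A _ mA; rewrite -Radon_Nikodym_integral// -pq.
apply: ae_eq_integral => //.
- by apply: measurableT_comp mg; exact: measurable_lne.
- by apply/measurable_EFinP; exact: measurableT_comp.
have gf' : ae_eq p setT g (EFin \o f) by exact: null_dominates_ae_eq pllq gf.
have f0' := ae_density_gt0 mf f0 pq.
apply: filterS2 gf' f0' => x /= gx fx _; rewrite gx//.
by rewrite lne_EFin.
Qed.

End density.

Lemma expRN_subr_ge0 (R : realType) (t : R) : 0 <= t - 1 + expR (- t).
Proof. by have := expR_ge1Dx (- t); lra. Qed.

Lemma expRN_subr_eq0 (R : realType) (t : R) : t - 1 + expR (- t) = 0 -> t = 0.
Proof.
have [->//|t0] := eqVneq t 0; have : - t != 0 by rewrite oppr_eq0.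
by move=> /expR_gt1Dx; lra.
Qed.

(** The claim amounts to -2t <= exp(-t). With y = exp(-t/2) >= 1 - t/2, the square (y - 2)^2 >= 0
    gives y^2 >= 4y - 4 >= -2t. It serves to show that the gap has infinite integral whenever 1/f
    has. *)
Lemma expRN_le_gap (R : realType) (t : R) :
  expR (- t) <= 2 * (t - 1 + expR (- t)) + 2.
Proof.
suff : - t * 2 <= expR (- t) by lra.
have : 1 + - t / 2 <= expR (- t / 2) := expR_ge1Dx _.
have -> : expR (- t) = expR (- t / 2) ^+ 2.
  by rewrite -expRM_natl; congr expR; field.
have := sqr_ge0 (expR (- t / 2) - 2); nra.
Qed.

Section KL.
Local Open Scope ereal_scope.
Context d (S : measurableType d) (R : realType).
Implicit Types p q r : probability S R.

(** [X] need not be integrable. Since X + Y = Z >= 0, its negative part is at most [Y] and has a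
    finite integral, so only that finite quantity is ever subtracted. *)
Lemma integral_sub_eq (mu : {measure set S -> \bar R}) (X Y Z : S -> R) :
  measurable_fun setT X -> measurable_fun setT Y -> measurable_fun setT Z ->
  (forall x, (0 <= Y x)%R) -> (forall x, (0 <= Z x)%R) ->
  (forall x, (X x + Y x = Z x)%R) -> \int[mu]_x (Y x)%:E < +oo ->
  \int[mu]_x (X x)%:E + \int[mu]_x (Y x)%:E = \int[mu]_x (Z x)%:E.
Proof.
move=> mX mY mZ Y0 Z0 XYZ Yoo.
have mXE : measurable_fun setT (EFin \o X) by exact/measurable_EFinP.
have mYE : measurable_fun setT (EFin \o Y) by exact/measurable_EFinP.
have mZE : measurable_fun setT (EFin \o Z) by exact/measurable_EFinP.
have mXp := measurable_funepos mXE; have mXn := measurable_funeneg mXE.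
rewrite integralE -/(EFin \o X).
have Xnoo : \int[mu]_x (EFin \o X)^\- x < +oo.
  apply: le_lt_trans Yoo; apply: ge0_le_integral => //.
  - move=> x _; rewrite funenegE /= -EFin_max lee_fin ge_max Y0 andbT.
    by have := XYZ x; have := Z0 x; lra.
have Xnfin : \int[mu]_x (EFin \o X)^\- x \is a fin_num.
  by rewrite ge0_fin_numE// integral_ge0.
have : \int[mu]_x (EFin \o X)^\+ x + \int[mu]_x (Y x)%:E =
       \int[mu]_x (Z x)%:E + \int[mu]_x (EFin \o X)^\- x.
  rewrite -!ge0_integralD//; try by move=> x _; rewrite lee_fin.
  apply: eq_integral => x _; rewrite funeposE funenegE /= -!EFin_max.
  rewrite -!EFinD -XYZ; congr EFin; rewrite /Num.max; do 2 case: ifP; lra.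
move=> /(congr1 (fun z => z - \int[mu]_x (EFin \o X)^\- x)).
by rewrite addeK// => <-; rewrite addeAC.
Qed.

Lemma exists_density (p q : probability S R) : p `<< q ->
  exists f : S -> R, [/\ measurable_fun setT f, forall x, (0 <= f x)%R
    & has_density p q f].
Proof.
move=> pq; exists (fine \o Radon_Nikodym_SigmaFinite.f p q).
have mf := measurable_int _ (Radon_Nikodym_SigmaFinite.f_integrable pq).
split.
- apply: (measurableT_comp _ mf); exact: fine_measurable.
- by move=> x /=; rewrite fine_ge0// Radon_Nikodym_SigmaFinite.f_ge0.
- move=> A mA; rewrite (Radon_Nikodym_SigmaFinite.f_integral pq)//.
  apply: eq_integral => x _ /=; rewrite fineK//.
  exact: Radon_Nikodym_SigmaFinite.f_fin_num.
Qed.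

(** Against [q] the integrand becomes (1/f) f, the indicator of f > 0. *)
Lemma integral_density_inv_le1 (r q : probability S R) (f : S -> R) :
  measurable_fun setT f -> (forall x, (0 <= f x)%R) -> has_density r q f ->
  \int[r]_x (expR (- ln (f x)))%:E <= 1.
Proof.
move=> mf f0 rq.
have ms : measurable_fun setT (fun x => expR (- ln (f x)))%R.
  apply: measurableT_comp => //; apply: measurableT_comp => //.
  exact: measurableT_comp.
rewrite (ge0_integral_density mf f0 rq)//; last exact/measurable_EFinP.
rewrite -(@probability_setT _ _ _ q) -[leRHS]mul1e -integral_cst//.
apply: ge0_le_integral => //.
- by move=> x _; rewrite -EFinM lee_fin mulr_ge0// expR_ge0.
- by apply/measurable_EFinP; exact: measurable_funM.
(* Where [f] vanishes the product is 0, whatever default value [ln] takes there. *)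
- move=> x _; rewrite -EFinM lee_fin; have := f0 x.
  rewrite le_eqVlt => /predU1P[<-|fx]; first by rewrite mulr0.
  by rewrite expRN lnK ?posrE// mulVf// gt_eqF.
Qed.

(** Pointwise, (a + ln f) + 1/f = a + 1 + (ln f - 1 + 1/f), where exp(a) f is the density of [p]
    with respect to [q]. The work lies in integrating this when [ln f] has no integrability of its
    own. *)
Lemma KL_identity0 p r q (a f : S -> R) :
  measurable_fun setT a -> has_density p r (expR \o a) ->
  p.-integrable setT (EFin \o a) ->
  measurable_fun setT f -> (forall x, (0 <= f x)%R) -> has_density r q f ->
  \int[p]_x (expR (- ln (f x)))%:E < +oo ->
  KL p q + \int[p]_x (expR (- ln (f x)))%:E =
  KL p r + 1 + \int[p]_x (ln (f x) - 1 + expR (- ln (f x)))%:E.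
Proof.
move=> ma pr ia mf f0 rq soo.
have mea : measurable_fun setT (expR \o a) by exact: measurableT_comp.
have ea0 x : (0 <= (expR \o a) x)%R by exact: expR_ge0.
have ml : measurable_fun setT (fun x => ln (f x)) by exact: measurableT_comp.
have ms : measurable_fun setT (fun x => expR (- ln (f x)))%R.
  by apply: measurableT_comp => //; apply: measurableT_comp.
have mhf : measurable_fun setT (fun x => (expR \o a) x * f x)%R.
  exact: measurable_funM.
have hf0 x : (0 <= (expR \o a) x * f x)%R by rewrite mulr_ge0.
have pq := has_densityM mea ea0 mf f0 pr rq.
rewrite (KL_density mhf hf0 pq) (KL_density mea ea0 pr).
have -> : \int[p]_x (ln ((expR \o a) x))%:E = \int[p]_x (EFin \o a) x.
  by apply: eq_integral => x _ /=; rewrite expRK.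
have -> : \int[p]_x (ln ((expR \o a) x * f x))%:E = \int[p]_x (a x + ln (f x))%:E.
  apply: ae_eq_integral => //.
  - by apply/measurable_EFinP; exact: measurableT_comp.
  - by apply/measurable_EFinP; exact: measurable_funD.
  - apply: filterS (ae_density_gt0 mhf hf0 pq) => x /= hfx _.
    have fx : (0 < f x)%R by move: hfx; rewrite pmulr_rgt0// expR_gt0.
    by rewrite lnM ?posrE ?expR_gt0// expRK.
pose ap x := Num.max (a x) 0%R; pose an x := Num.max (- a x)%R 0%R.
have map_ : measurable_fun setT ap by exact: measurable_maxr.
have man : measurable_fun setT an.
  by apply: measurable_maxr => //; exact: measurableT_comp.
have ap0 x : (0 <= ap x)%R by rewrite le_max lexx orbT.
have an0 x : (0 <= an x)%R by rewrite le_max lexx orbT.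
have apn x : (a x = ap x - an x)%R.
  by rewrite /ap /an /Num.max; do 2 case: ifP; lra.
have s0 x : (0 <= expR (- ln (f x)))%R by exact: expR_ge0.
have Eap : \int[p]_x (EFin \o a)^\+ x = \int[p]_x (ap x)%:E.
  by apply: eq_integral => x _; rewrite funeposE /= -EFin_max.
have Ean : \int[p]_x (EFin \o a)^\- x = \int[p]_x (an x)%:E.
  by apply: eq_integral => x _; rewrite funenegE /= -EFin_max.
have anfin : \int[p]_x (an x)%:E \is a fin_num.
  by rewrite -Ean; apply: integrable_neg_fin_num.
(* The negative part of [a] is moved across, so that [Y] and [Z] are both nonnegative; its finite
   integral is subtracted again at the end. *)
pose Y x := (expR (- ln (f x)) + an x)%R.
pose Z x := (ap x + (1 + (ln (f x) - 1 + expR (- ln (f x)))))%R.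
have md : measurable_fun setT (fun x => ln (f x) - 1 + expR (- ln (f x)))%R.
  by apply: measurable_funD => //; exact: measurable_funB.
have EY : \int[p]_x (Y x)%:E =
    \int[p]_x (expR (- ln (f x)))%:E + \int[p]_x (an x)%:E.
  under eq_integral do rewrite EFinD.
  rewrite ge0_integralD//; try (by move=> x _; rewrite lee_fin);
    exact/measurable_EFinP.
have EZ : \int[p]_x (Z x)%:E = \int[p]_x (ap x)%:E +
    (1 + \int[p]_x (ln (f x) - 1 + expR (- ln (f x)))%:E).
  under eq_integral do rewrite EFinD EFinD.
  rewrite ge0_integralD//=.
  - congr (_ + _); rewrite ge0_integralD//=.
    + congr (_ + _); exact: integral_probability_cst.
    + by move=> x _; rewrite lee_fin expRN_subr_ge0.
    + exact/measurable_EFinP.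
  - by move=> x _; rewrite lee_fin.
  - exact/measurable_EFinP.
  - by move=> x _; rewrite adde_ge0// lee_fin expRN_subr_ge0.
  - by apply: emeasurable_funD => //; exact/measurable_EFinP.
have : \int[p]_x (a x + ln (f x))%:E + \int[p]_x (Y x)%:E = \int[p]_x (Z x)%:E.
  apply: integral_sub_eq.
  - exact: measurable_funD.
  - exact: measurable_funD.
  - apply: measurable_funD => //; exact: measurable_funD.
  - by move=> x; rewrite addr_ge0.
  - move=> x; apply: addr_ge0 => //; apply: addr_ge0 => //.
    exact: expRN_subr_ge0.
  - by move=> x; rewrite /Y /Z apn; lra.
  - by rewrite EY lte_add_pinfty// ltey_eq anfin.
rewrite EY EZ (integralE p _ (EFin \o a)) Eap Ean => H.
rewrite -[LHS](addeK _ anfin) -(addeA (integral _ _ _)) H.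
by rewrite addeAC addeA.
Qed.

(** In the identity with r = p and a = 0, the right side is 1 plus a nonnegative gap, while the
    integral of 1/f on the left is at most 1. *)
Lemma KL_ge0 (p q : probability S R) : 0 <= KL p q.
Proof.
have [pq|npq] := pselect (p `<< q); last first.
  by rewrite /KL ifF//; apply/asboolP.
have [f [mf f0 pqf]] := exists_density pq.
have le1 := integral_density_inv_le1 mf f0 pqf.
have lty := le_lt_trans le1 (ltry 1).
have pp : has_density p p (expR \o cst 0%R).
  move=> A mA; rewrite /= expR0 integral_cst// mul1e //.
have i0 : p.-integrable setT (EFin \o cst 0%R) by exact: integrable0.
have := KL_identity0 _ pp i0 mf f0 pqf lty.
have -> : KL p p = 0.
  rewrite (KL_density _ _ pp)//; last by move=> x; exact: expR_ge0.
  by rewrite integral0_eq// => x _ /=; rewrite expRK.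
rewrite add0e => /(_ (measurable_cst _)) E.
have : 1 <= KL p q + \int[p]_x (expR (- ln (f x)))%:E.
  rewrite E leeDl//; apply: integral_ge0 => x _.
  by rewrite lee_fin expRN_subr_ge0.
move=> /le_trans/(_ (leeD (lexx _) le1)).
by rewrite -[leLHS]add0e leeD2rE.
Qed.

(** Removes the finiteness assumption on the integral of 1/f: if it is infinite, [expRN_le_gap]
    makes the gap infinite too, and [KL_ge0] excludes the undefined sum of opposite infinities, so
    both sides are +oo. *)
Lemma KL_identity p r q (a f : S -> R) :
  measurable_fun setT a -> has_density p r (expR \o a) ->
  p.-integrable setT (EFin \o a) ->
  measurable_fun setT f -> (forall x, (0 <= f x)%R) -> has_density r q f ->
  KL p q + \int[p]_x (expR (- ln (f x)))%:E =
  KL p r + 1 + \int[p]_x (ln (f x) - 1 + expR (- ln (f x)))%:E.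
Proof.
move=> ma pr ia mf f0 rq.
have := leey (\int[p]_x (expR (- ln (f x)))%:E).
rewrite le_eqVlt => /predU1P[soo|]; last exact: KL_identity0 ma pr ia mf f0 rq.
have mea : measurable_fun setT (expR \o a) by exact: measurableT_comp.
have ea0 x : (0 <= (expR \o a) x)%R by exact: expR_ge0.
have ms : measurable_fun setT (fun x => expR (- ln (f x)))%R.
  by apply: measurableT_comp => //; apply: measurableT_comp => //; exact: measurableT_comp.
have md : measurable_fun setT (fun x => ln (f x) - 1 + expR (- ln (f x)))%R.
  by apply: measurable_funD => //; apply: measurable_funB => //; exact: measurableT_comp.
rewrite soo addey; last first.
  by rewrite -ltNye (lt_le_trans (ltNyr 0))// KL_ge0.
suff -> : \int[p]_x (ln (f x) - 1 + expR (- ln (f x)))%:E = +oo.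
  by rewrite addey// -ltNye (lt_le_trans (ltNyr 0))// adde_ge0// KL_ge0.
apply/eqP; rewrite -leye_eq leNgt; apply/negP => Doo.
have : \int[p]_x (expR (- ln (f x)))%:E <=
    2%:E * \int[p]_x (ln (f x) - 1 + expR (- ln (f x)))%:E + 2%:E.
  rewrite -ge0_integralZl_EFin//; last 2 first.
  - by move=> x _; rewrite lee_fin expRN_subr_ge0.
  - exact/measurable_EFinP.
  have {2}-> : 2%:E = \int[p]_x (cst 2%:E x) :> \bar R.
    by rewrite integral_probability_cst.
  rewrite -ge0_integralD//.
  - apply: ge0_le_integral => //.
    + exact/measurable_EFinP.
    + apply: emeasurable_funD => //; apply: measurable_funeM; exact/measurable_EFinP.
    + by move=> x _; rewrite -EFinM -EFinD lee_fin expRN_le_gap.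
  - by move=> x _; rewrite -EFinM lee_fin mulr_ge0// expRN_subr_ge0.
  - apply: measurable_funeM; exact/measurable_EFinP.
  - by move=> x _; rewrite lee_fin.
rewrite soo leye_eq => /eqP; apply/eqP; rewrite lt_eqF//.
by rewrite lte_add_pinfty ?ltry// lte_mul_pinfty.
Qed.

End KL.

(** * Relative entropy averaged over a kernel *)

Section averaged_KL.
Local Open Scope ereal_scope.

Lemma measurable_fun_integral_section d1 d2 (T1 : measurableType d1)
    (T2 : measurableType d2) (R : realType)
    (mu : {sigma_finite_measure set T2 -> \bar R}) (F : T1 * T2 -> \bar R) :
  measurable_fun setT F ->
  measurable_fun setT (fun x => \int[mu]_y F (x, y)).
Proof.
move=> mF.
rewrite (_ : (fun x => _) = fun x =>
    \int[mu]_y F^\+ (x, y) - \int[mu]_y F^\- (x, y)); last first.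
  apply/funext => x; rewrite integralE.
  by congr (_ - _); apply: eq_integral => y _; rewrite ?funeposE ?funenegE.
apply: emeasurable_funB.
- apply: (measurable_fun_fubini_tonelli_F F^\+); first exact: measurable_funepos.
  exact: funepos_ge0.
- apply: (measurable_fun_fubini_tonelli_F F^\-); first exact: measurable_funeneg.
  exact: funeneg_ge0.
Qed.

(** The inequality on the complement of [A] is the reverse inequality on [A], the total masses being
    equal. *)
Lemma probability_le_eq d (S : measurableType d) (R : realType)
    (p q : probability S R) :
  (forall A, measurable A -> p A <= q A) -> same_law p q.
Proof.
move=> pq A mA; apply/eqP; rewrite eq_le pq//=.
have := pq _ (measurableC mA); rewrite !probability_setC//.
by rewrite leeBrDl ?fin_numB ?fin_num_measure// addeA leeBlDr ?fin_num_measure// addeC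
  leeD2lE.
Qed.

Lemma ge0_integral_identity d (S : measurableType d) (R : realType)
    (p : probability S R) (k1 k2 s t : S -> \bar R) :
  measurable_fun setT k1 -> measurable_fun setT k2 ->
  measurable_fun setT s -> measurable_fun setT t ->
  (forall x, 0 <= k1 x) -> (forall x, 0 <= k2 x) ->
  (forall x, 0 <= s x) -> (forall x, 0 <= t x) ->
  (forall x, k1 x + s x = k2 x + 1 + t x) ->
  \int[p]_x k1 x + \int[p]_x s x = \int[p]_x k2 x + 1 + \int[p]_x t x.
Proof.
move=> mk1 mk2 ms mt k10 k20 s0 t0 E.
rewrite -ge0_integralD//; under eq_integral do rewrite E -addeA.
rewrite ge0_integralD//; last 2 first.
- by move=> x _; rewrite adde_ge0.
- exact: emeasurable_funD.
rewrite -addeA; congr (_ + _); rewrite ge0_integralD//; congr (_ + _).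
exact: integral_probability_cst.
Qed.

Lemma le_of_identity (R : realType) (k1 k2 s t : \bar R) :
  s <= 1 -> 0 <= t -> k1 + s = k2 + 1 + t -> k2 <= k1.
Proof.
move=> s1 t0 E; rewrite -(leeD2rE _ _ (isT : (1 : \bar R) \is a fin_num)).
by apply: (@le_trans _ _ (k1 + s)); rewrite ?E ?leeDl// -E leeD2l.
Qed.

Lemma adde_fin_inj (R : realType) (c s t : \bar R) :
  c \is a fin_num -> c + s = c + t -> s = t.
Proof.
move=> cfin /(congr1 (fun z => z - c)).
by rewrite addeAC subee// add0e addeAC subee// add0e.
Qed.

(** The integral of 1/f is at most 1, so the equation forces the gap integral to vanish and 1/f = 1
    holds [r]-a.e. Then r A is the integral of 1/f over [A] against [r], which is at most q A, and
    two ordered probabilities are equal. *)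
Lemma density_gap_eq d (S : measurableType d) (R : realType)
    (r q : probability S R) (f : S -> R) :
  measurable_fun setT f -> (forall x, (0 <= f x)%R) -> has_density r q f ->
  \int[r]_u (expR (- ln (f u)))%:E =
    1 + \int[r]_u (ln (f u) - 1 + expR (- ln (f u)))%:E ->
  same_law q r.
Proof.
move=> mf f0 rqf.
have ms : measurable_fun setT (fun x => expR (- ln (f x)))%R.
  by apply: measurableT_comp => //; apply: measurableT_comp => //; exact: measurableT_comp.
have md : measurable_fun setT (fun x => ln (f x) - 1 + expR (- ln (f x)))%R.
  by apply: measurable_funD => //; apply: measurable_funB => //; exact: measurableT_comp.
have := integral_density_inv_le1 mf f0 rqf.
set K := \int[r]_u _ => K1; set D := \int[r]_u _ => KD.
have D0 : D = 0.
  apply/le_anti; rewrite integral_ge0 ?andbT; last first.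
    by move=> u _; rewrite lee_fin expRN_subr_ge0.
  by move: K1; rewrite KD -[leRHS]adde0 leeD2lE.
have s1 : ae_eq r setT (fun u => (expR (- ln (f u)))%:E) (cst 1).
  have : ae_eq r setT (fun u => (ln (f u) - 1 + expR (- ln (f u)))%:E) (cst 0).
    apply/ae_eq_integral_abs => //; first exact/measurable_EFinP.
    rewrite -[RHS]D0; apply: eq_integral => u _.
    by rewrite gee0_abs// lee_fin expRN_subr_ge0.
  apply: filterS => u /= /(_ I)[] /expRN_subr_eq0 -> _.
  by rewrite oppr0 expR0.
suff rle A : measurable A -> r A <= q A.
  by move=> A mA; rewrite (probability_le_eq rle).
move=> mA; have -> : r A = \int[r]_(u in A) (expR (- ln (f u)))%:E.
  transitivity (\int[r]_(u in A) cst 1 u); first by rewrite integral_cst// mul1e.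
  apply: ae_eq_integral => //; last first.
    by apply: ae_eq_sym; exact: ae_eq_subset s1.
  by apply: measurable_funTS; exact/measurable_EFinP.
rewrite (ge0_integral_density_in mf f0 rqf)//; last exact/measurable_EFinP.
rewrite -[leRHS]mul1e -integral_cst//.
apply: ge0_le_integral => //.
- by move=> x _; rewrite -EFinM lee_fin mulr_ge0// expR_ge0.
- by apply: measurable_funTS; apply/measurable_EFinP; exact: measurable_funM.
- move=> x _; rewrite -EFinM lee_fin; have := f0 x.
  rewrite le_eqVlt => /predU1P[<-|fx]; first by rewrite mulr0.
  by rewrite expRN lnK ?posrE// mulVf// gt_eqF.
Qed.

Context d d1 d2 (Om : measurableType d) (E : measurableType d1)
  (U : measurableType d2) (R : realType) (Pr : probability Om R).
Variables (X : Om -> E) (kappa : E -> probability U R) (r : probability U R).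
Variables (mu : {sigma_finite_measure set U -> \bar R}).
Variables (g : E * U -> R) (gs : U -> R).
Hypotheses (mX : measurable_fun setT X) (mg : measurable_fun setT g)
  (g0 : forall z, (0 < g z)%R) (mgs : measurable_fun setT gs)
  (gs0 : forall u, (0 < gs u)%R).
Hypothesis kappa_mu : forall x, has_density (kappa x) mu (fun u => g (x, u)).
Hypothesis r_mu : has_density r mu gs.
Hypothesis mixture : forall f : U -> \bar R, measurable_fun setT f ->
  (forall u, 0 <= f u) ->
  \int[Pr]_om \int[kappa (X om)]_u f u = \int[r]_u f u.

(** The logarithm of the density of [kappa x] with respect to [r]. Integrability for each x gives
    the pointwise identity; the averaged bound [ia2] makes the optimal value finite. *)
Let a x u : R := (ln (g (x, u)) - ln (gs u))%R.

Hypothesis ia : forall x, (kappa x).-integrable setT (EFin \o a x).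
Hypothesis ia2 : \int[Pr]_om \int[kappa (X om)]_u `|(a (X om) u)%:E| < +oo.

Let mgx x : measurable_fun setT (fun u => g (x, u)).
Proof. by apply: measurableT_comp => //; exact: measurable_pair1. Qed.

Let ma x : measurable_fun setT (a x).
Proof. by apply: measurable_funB; exact: measurableT_comp. Qed.

Let kappa_r x : has_density (kappa x) r (expR \o a x).
Proof.
have := has_density_div (@mgx x) (fun u => ltW (g0 (x, u))) mgs gs0 (@kappa_mu x) r_mu.
congr (has_density _ _ _); apply/funext => u /=.
by rewrite expRD lnK// posrE.
Qed.

(** All [kappa x] have densities with respect to the same [mu], jointly measurable in x and u, so
    the measurability part of Tonelli's theorem applies to the positive and negative parts. *)
Let mkappa (F : E * U -> \bar R) : measurable_fun setT F ->
  measurable_fun setT (fun om => \int[kappa (X om)]_u F (X om, u)).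
Proof.
move=> mF.
pose G (z : E * U) := F z * (g z)%:E.
have mG : measurable_fun setT G by apply: emeasurable_funM => //; exact/measurable_EFinP.
rewrite (_ : (fun om => _) = (fun x => \int[mu]_u G (x, u)) \o X).
  by apply: measurableT_comp mX; exact: measurable_fun_integral_section.
apply/funext => om /=; apply: (integral_density (mgx _) _ (@kappa_mu _)).
  by move=> u; exact: ltW.
by apply: measurableT_comp => //; exact: measurable_pair1.
Qed.

(** Positivity of [g] gives r << mu << kappa x, so kappa x << q would imply r << q. *)
Let KL_noac (q : probability U R) x : ~ r `<< q -> KL (kappa x) q = +oo.
Proof.
move=> nrq; rewrite /KL ifF//; apply/asboolP => kq; apply: nrq.
apply: null_dominates_trans kq.
apply: (@null_dominates_trans _ _ _ _ mu).
  exact: density_null_dominates r_mu.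
exact: gt0_density_null_dominates (@kappa_mu x).
Qed.

Let KL_r x : KL (kappa x) r = \int[kappa x]_u (a x u)%:E.
Proof.
rewrite (KL_density _ _ (@kappa_r x)).
- by apply: eq_integral => u _ /=; rewrite expRK.
- exact: measurableT_comp.
- by move=> u; exact: expR_ge0.
Qed.

(** Either [q] does not dominate [r] and the function is constantly +oo, or the divergence is the
    [kappa]-integral of one jointly measurable function. *)
Lemma measurable_KL_mixture (q : probability U R) :
  measurable_fun setT (fun om => KL (kappa (X om)) q).
Proof.
have [rq|nrq] := pselect (r `<< q); last first.
  rewrite (_ : (fun om => _) = cst +oo); first exact: measurable_cst.
  by apply/funext => om; exact: KL_noac.
have [f [mf f0 rqf]] := exists_density rq.
pose F (z : E * U) := (ln (expR (ln (g z) - ln (gs z.2)) * f z.2))%:E : \bar R.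
rewrite (_ : (fun om => _) = fun om => \int[kappa (X om)]_u F (X om, u)).
  apply: mkappa; apply/measurable_EFinP; apply: measurableT_comp => //.
  apply: measurable_funM; last by apply: measurableT_comp => //.
  apply: measurableT_comp => //; apply: measurable_funB.
    exact: measurableT_comp.
  by apply: measurableT_comp => //; exact: measurableT_comp.
apply/funext => om.
have mea : measurable_fun setT (expR \o a (X om)) by exact: measurableT_comp.
have ea0 u : (0 <= (expR \o a (X om)) u)%R by exact: expR_ge0.
rewrite (KL_density _ _ (has_densityM mea ea0 mf f0 (@kappa_r _) rqf))//.
- exact: measurable_funM.
- by move=> u; rewrite mulr_ge0.
Qed.

Lemma integral_KL_mixture_lty : \int[Pr]_om KL (kappa (X om)) r < +oo.
Proof.
apply: le_lt_trans ia2; apply: ge0_le_integral => //.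
- by move=> om _; exact: KL_ge0.
- exact: measurable_KL_mixture.
- apply: (@mkappa (fun z => `|(ln (g z) - ln (gs z.2))%:E|)).
  apply: measurableT_comp => //; apply/measurable_EFinP.
  apply: measurable_funB; first exact: measurableT_comp.
  by apply: measurableT_comp => //; exact: measurableT_comp.
- move=> om _; rewrite KL_r; apply: le_trans (lee_abs _) _.
  by apply: le_abse_integral => //; exact/measurable_EFinP.
Qed.

(** Averages the identity over the state. By [mixture], the integrals of 1/f and of the gap against
    [kappa (X om)] become integrals against [r], where 1/f is controlled. *)
Let integral_KL_identity (q : probability U R) (f : U -> R) :
  measurable_fun setT f -> (forall x, (0 <= f x)%R) -> has_density r q f ->
  \int[Pr]_om KL (kappa (X om)) q + \int[r]_u (expR (- ln (f u)))%:E =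
  \int[Pr]_om KL (kappa (X om)) r + 1 +
  \int[r]_u (ln (f u) - 1 + expR (- ln (f u)))%:E.
Proof.
move=> mf f0 rqf.
have ms : measurable_fun setT (fun x => expR (- ln (f x)))%R.
  by apply: measurableT_comp => //; apply: measurableT_comp => //; exact: measurableT_comp.
have md : measurable_fun setT (fun x => ln (f x) - 1 + expR (- ln (f x)))%R.
  by apply: measurable_funD => //; apply: measurable_funB => //; exact: measurableT_comp.
have s0 u : 0 <= (expR (- ln (f u)))%:E by rewrite lee_fin expR_ge0.
have d0 u : 0 <= (ln (f u) - 1 + expR (- ln (f u)))%:E.
  by rewrite lee_fin expRN_subr_ge0.
have msE : measurable_fun setT (fun u => (expR (- ln (f u)))%:E) by exact/measurable_EFinP.
have mdE : measurable_fun setT (fun u => (ln (f u) - 1 + expR (- ln (f u)))%:E).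
  exact/measurable_EFinP.
rewrite -(mixture msE s0) -(mixture mdE d0); apply: ge0_integral_identity.
- exact: measurable_KL_mixture.
- exact: measurable_KL_mixture.
- apply: (@mkappa (fun z => (expR (- ln (f z.2)))%:E)).
  by apply/measurable_EFinP; exact: (measurableT_comp ms measurable_snd).
- apply: (@mkappa (fun z => (ln (f z.2) - 1 + expR (- ln (f z.2)))%:E)).
  by apply/measurable_EFinP; exact: (measurableT_comp md measurable_snd).
- move=> om; exact: KL_ge0.
- move=> om; exact: KL_ge0.
- move=> om; apply: integral_ge0 => u _; exact: s0.
- move=> om; apply: integral_ge0 => u _; exact: d0.
- move=> om; exact: (KL_identity (@ma _) (@kappa_r _) (@ia _) mf f0 rqf).
Qed.

Lemma integral_KL_mixture_min (q : probability U R) :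
  \int[Pr]_om KL (kappa (X om)) r <= \int[Pr]_om KL (kappa (X om)) q.
Proof.
have [rq|nrq] := pselect (r `<< q); last first.
  under [leRHS]eq_integral do rewrite KL_noac//.
  by rewrite integral_probability_cst leey.
have [f [mf f0 rqf]] := exists_density rq.
apply: le_of_identity (integral_KL_identity mf f0 rqf).
  exact: integral_density_inv_le1 rqf.
by apply: integral_ge0 => u _; rewrite lee_fin expRN_subr_ge0.
Qed.

(** The common divergence is finite and cancels from the averaged identity; what remains is exactly
    the hypothesis of [density_gap_eq]. *)
Lemma integral_KL_mixture_eq (q : probability U R) :
  \int[Pr]_om KL (kappa (X om)) q = \int[Pr]_om KL (kappa (X om)) r ->
  same_law q r.
Proof.
move=> eqKL.
have fin : \int[Pr]_om KL (kappa (X om)) r \is a fin_num.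
  rewrite ge0_fin_numE; first exact: integral_KL_mixture_lty.
  by apply: integral_ge0 => om _; exact: KL_ge0.
have [rq|nrq] := pselect (r `<< q); last first.
  move: eqKL fin => <-; under eq_integral do rewrite KL_noac//.
  by rewrite integral_probability_cst.
have [f [mf f0 rqf]] := exists_density rq.
apply: (density_gap_eq mf f0 rqf).
have := integral_KL_identity mf f0 rqf; rewrite eqKL -addeA.
exact: adde_fin_inj.
Qed.

End averaged_KL.

(** * Positive definite quadratic forms *)

Section quadratic_forms.
Context {R : realType}.

Definition qform n (M : 'M[R]_n) (v : 'cV[R]_n) : R := (v^T *m M *m v) 0 0.

Lemma qform0 n (M : 'M[R]_n) : qform M 0 = 0.
Proof. by rewrite /qform mulmx0 mxE. Qed.

Lemma qformE n (M : 'M[R]_n) v :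
  qform M v = \sum_i \sum_j v j 0 * M j i * v i 0.
Proof.
rewrite /qform mxE; apply: eq_bigr => i _; rewrite mxE mulr_suml.
by apply: eq_bigr => j _; rewrite mxE.
Qed.

Lemma qform_ge0 n (M : 'M[R]_n) v : posdefmx M -> 0 <= qform M v.
Proof.
move=> [_ M0]; have [->|/M0/ltW//] := eqVneq v 0.
by rewrite qform0.
Qed.

Lemma posdefmx_unit n (M : 'M[R]_n) : posdefmx M -> M \in unitmx.
Proof.
move=> [MT M0]; rewrite -row_free_unit -kermx_eq0; apply/eqP/row_matrixP => i.
set v := row i (kermx M).
have vM : v *m M = 0 by apply/sub_kermxP; exact: row_sub.
apply/eqP; rewrite row0; apply/negPn/negP => v0.
have vT0 : v^T != 0 by rewrite -(inj_eq trmx_inj) trmxK trmx0.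
by have := M0 _ vT0; rewrite trmxK vM mul0mx mxE ltxx.
Qed.

Lemma posdefmx_inv n (M : 'M[R]_n) : posdefmx M -> posdefmx (invmx M).
Proof.
move=> Mpd; have Mu := posdefmx_unit Mpd; case: (Mpd) => MT M0; split.
  by rewrite trmx_inv MT.
move=> v v0; have := M0 (invmx M *m v).
rewrite trmx_mul trmx_inv MT mulmxKV// mulmxA.
apply; apply: contra v0 => /eqP/(congr1 (mulmx M)).
by rewrite mulKVmx// mulmx0 => ->.
Qed.

Lemma posdefmxD_congr n m (M : 'M[R]_m) (N : 'M[R]_n) (P : 'M[R]_(m, n)) :
  posdefmx M -> posdefmx N -> posdefmx (M + P *m N *m P^T).
Proof.
move=> [MT M0] Npd; split.
  by rewrite linearD /= MT !trmx_mul trmxK Npd.1 mulmxA.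
move=> v v0; rewrite mulmxDr mulmxDl mxE ltr_pwDl ?M0//.
have := qform_ge0 (P^T *m v) Npd.
by rewrite /qform trmx_mul trmxK !mulmxA.
Qed.

(** Completing the square in the first coordinate: [b] is the rest of the first row and [S] the
    Schur complement of [a]. The splitting [col_mx z%:M y] is that of [colvec_cons], so this is the
    inductive step for both determinants and Gaussian integrals. *)
Lemma posdefmx_schur n (M : 'M[R]_(1 + n)) : posdefmx M ->
  let a := M 0 0 in let b := ursubmx M in
  let S := drsubmx M - a^-1 *: (b^T *m b) in
  [/\ 0 < a, posdefmx S, \det M = a * \det S
    & forall z y, qform M (col_mx z%:M y) =
        a * (z + (b *m y) 0 0 / a) ^+ 2 + qform S y].
Proof.
move=> [MT M0] a b S.
have ulE : ulsubmx M = a%:M.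
  rewrite [LHS]mx11_scalar; congr (_%:M); rewrite !mxE; congr (M _ _); exact/val_inj.
have dlE : dlsubmx M = b^T by rewrite /b -[in LHS]MT trmx_ursub.
have qE z y : qform M (col_mx z%:M y) =
    a * z ^+ 2 + 2 * z * (b *m y) 0 0 + qform (drsubmx M) y.
  rewrite /qform -[M]submxK ulE dlE -/b tr_col_mx mul_row_block mul_row_col.
  rewrite tr_scalar_mx !mulmxDl -!mulmxA !mul_scalar_mx.
  rewrite block_mxKdr mul_mx_scalar -scalemxAr -trmx_mul.
  move: (b *m y) (y^T *m _) => t q.
  rewrite !mxE eqxx mulr1n; ring.
have a0 : 0 < a.
  have v0 : col_mx (1%:M : 'M[R]_1) (0 : 'cV[R]_n) != 0.
    rewrite col_mx_eq0 negb_and; apply/orP; left; exact: oner_neq0.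
  have := M0 _ v0; rewrite -/(qform _ _) qE qform0 mulmx0 !mxE; lra.
have SE y : qform S y = qform (drsubmx M) y - a^-1 * (b *m y) 0 0 ^+ 2.
  rewrite /qform /S mulmxBr mulmxBl -scalemxAr -scalemxAl mulmxA -trmx_mul.
  rewrite -(mulmxA _ b) [b *m y]mx11_scalar tr_scalar_mx -scalar_mxM.
  move: (y^T *m _ *m _) ((b *m y) 0 0) => q t.
  by rewrite !mxE eqxx mulr1n expr2.
have sq z y : qform M (col_mx z%:M y) =
        a * (z + (b *m y) 0 0 / a) ^+ 2 + qform S y.
  by rewrite qE SE; field; rewrite gt_eqF.
split => //.
- split.
    rewrite /S linearB /= linearZ /= trmx_mul trmxK; congr (_ - _).
    by rewrite trmx_drsub MT.
  (* This first coordinate cancels the square and leaves [qform S y]. *)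
  move=> y y0; have := M0 (col_mx (- ((b *m y) 0 0 / a))%:M y).
  rewrite -!/(qform _ _) sq addNr expr0n mulr0 add0r; apply.
  by rewrite col_mx_eq0 negb_and y0 orbT.
(* Block LU factorization with pivot [a]. *)
- have -> : M = block_mx 1%:M 0 (a^-1 *: b^T) 1%:M *m block_mx a%:M b 0 S.
    rewrite mulmx_block !mul1mx !mul0mx !addr0.
    rewrite -scalemxAl mul_mx_scalar scalerA mulVf ?gt_eqF// scale1r.
    by rewrite -scalemxAl /S addrC subrK -{1}[M]submxK ulE dlE.
  by rewrite det_mulmx det_lblock det_ublock !det1 !mul1r det_scalar1.
Qed.

Lemma posdefmx_det_gt0 n (M : 'M[R]_n) : posdefmx M -> 0 < \det M.
Proof.
elim: n M => [M _|n IH M Mpd]; first by rewrite det_mx00.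
by have [a0 /IH S0 -> _] := @posdefmx_schur n M Mpd; rewrite mulr_gt0.
Qed.

(** Sylvester's identity. The same two block matrices multiplied in either order give block
    triangular products, with diagonal blocks 1 + AB, 1 and 1, 1 + BA respectively. *)
Lemma det1D_mulmxC n m (A : 'M[R]_(m, n)) (B : 'M[R]_(n, m)) :
  \det (1%:M + A *m B) = \det (1%:M + B *m A).
Proof.
have : \det (block_mx 1%:M A (- B) 1%:M *m block_mx 1%:M 0 B 1%:M) =
       \det (block_mx 1%:M 0 B 1%:M *m block_mx 1%:M A (- B) 1%:M).
  by rewrite !det_mulmx mulrC.
rewrite !mulmx_block !mul1mx !mulmx1 !mulmx0 !mul0mx !add0r !addr0 subrr addNr.
by rewrite det_ublock det_ublock !det1 mulr1 mul1r (addrC (B *m A)).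
Qed.

Lemma qform_parallelogram n (M : 'M[R]_n) a b :
  qform M (a + b) + qform M (a - b) = 2 * qform M a + 2 * qform M b.
Proof.
rewrite /qform [(a + b)^T]linearD [(a - b)^T]linearB /=.
rewrite !(mulmxDl, mulmxDr, mulNmx, mulmxN).
move: (a^T *m _ *m a) (a^T *m _ *m b) (b^T *m _ *m a) (b^T *m _ *m b) => A B C D.
rewrite !mxE; ring.
Qed.

Lemma qformD_le n (M : 'M[R]_n) a b : posdefmx M ->
  qform M (a + b) <= 2 * qform M a + 2 * qform M b.
Proof.
by move=> Mpd; rewrite -qform_parallelogram lerDl qform_ge0.
Qed.

(** Cauchy-Schwarz for the inner product of [invmx M], in which v_i is the product of v with M e_i
    and M e_i has squared norm M_ii. It comes from nonnegativity at the residual of the projection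
    of v onto M e_i. *)
Lemma sqr_coord_le_qform n (M : 'M[R]_n) (v : 'cV[R]_n) i : posdefmx M ->
  v i 0 ^+ 2 <= M i i * qform (invmx M) v.
Proof.
move=> Mpd; have Mu := posdefmx_unit Mpd; have [MT M0] := Mpd.
pose e : 'cV[R]_n := delta_mx i 0.
have eMe : (e^T *m M *m e) 0 0 = M i i.
  by rewrite trmx_delta -rowE -colE !mxE.
have Mii0 : 0 < M i i.
  rewrite -eMe M0//; apply/eqP => /matrixP/(_ i 0)/eqP.
  by rewrite !mxE !eqxx oner_eq0.
have eT : (M *m e)^T = e^T *m M by rewrite trmx_mul MT.
have ve : (e^T *m v) 0 0 = v i 0 by rewrite trmx_delta -rowE mxE.
have vTe : (v^T *m e) 0 0 = v i 0 by rewrite -colE !mxE.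
have := qform_ge0 (v - (v i 0 / M i i) *: (M *m e)) (posdefmx_inv Mpd).
rewrite /qform [(v - _)^T]linearB /= linearZ /= eT !(mulmxBl, mulmxBr) -!scalemxAl -!scalemxAr.
rewrite !mulmxA (mulmxK Mu) -(mulmxA _ (invmx M) M) (mulVmx Mu) mulmx1.
move: eMe ve vTe; move: (e^T *m M *m e) (e^T *m v) (v^T *m e) (v^T *m _ *m v) => A B C D.
rewrite !mxE => -> -> ->; move: (v i 0) (D 0 0) => x y H.
have := mulr_ge0 (ltW Mii0) H.
suff -> : M i i * (y - x / M i i * x - (x / M i i * x - x / M i i * (x / M i i * M i i)))
  = M i i * y - x ^+ 2 by rewrite subr_ge0.
by field; rewrite gt_eqF.
Qed.

(** Any quadratic form is dominated coordinatewise: |x y| <= (x^2 + y^2)/2 for each pair of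
    coordinates, and each square is bounded by [sqr_coord_le_qform]. The constant is the resulting
    sum. *)
Lemma qform_le_qform_inv n (M S : 'M[R]_n) : posdefmx S ->
  exists2 C, 0 <= C & forall v, qform M v <= C * qform (invmx S) v.
Proof.
(* At the i-th unit vector the coordinate bound reads 1 <= S_ii Q with Q >= 0, so S_ii cannot be
   negative. *)
move=> Spd; have Sii i : 0 <= S i i.
  have := sqr_coord_le_qform (delta_mx i 0) i Spd.
  rewrite !mxE !eqxx expr1n => le1; rewrite leNgt; apply/negP => /ltW Si.
  have := mulr_le0_ge0 Si (qform_ge0 (delta_mx i 0) (posdefmx_inv Spd)).
  by move/(le_trans le1); rewrite ler10.
exists (\sum_i \sum_j `|M j i| * ((S i i + S j j) / 2)).
  apply: sumr_ge0 => i _; apply: sumr_ge0 => j _.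
  by rewrite mulr_ge0// divr_ge0// addr_ge0.
move=> v; rewrite [leLHS]qformE.
rewrite mulr_suml; apply: ler_sum => i _; rewrite mulr_suml; apply: ler_sum => j _.
have := sqr_coord_le_qform v i Spd; have := sqr_coord_le_qform v j Spd.
move: (qform _ v) (v i 0) (v j 0) (M j i) (S i i) (S j j) => Q x y c s t yQ xQ.
apply: le_trans (ler_norm _) _; rewrite mulrAC mulrC normrM -mulrA ler_wpM2l//.
rewrite ler_norml; apply/andP; split.
  by have := sqr_ge0 (x + y); nra.
by have := sqr_ge0 (x - y); nra.
Qed.

Section completing_the_square.
Context (n m : nat).
Variables (S : 'M[R]_m) (Sig : 'M[R]_n) (P : 'M[R]_(m, n)).
Hypotheses (Spd : posdefmx S) (Sigpd : posdefmx Sig).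

(* The law of x given u is N(mu + posterior_gain *m (u - P mu - q), posterior_precision^-1)
   when x ~ N(mu, Sig) and u ~ N(P x + q, S) given x. *)
Definition posterior_precision := invmx Sig + P^T *m invmx S *m P.
Definition posterior_gain := invmx posterior_precision *m P^T *m invmx S.

Lemma posterior_precision_posdef : posdefmx posterior_precision.
Proof.
have := posdefmxD_congr P^T (posdefmx_inv Sigpd) (posdefmx_inv Spd).
by rewrite trmxK.
Qed.

Let St := S + P *m Sig *m P^T.
Let L := posterior_precision.
Let Lu : L \in unitmx := posdefmx_unit posterior_precision_posdef.
Let Su := posdefmx_unit Spd.
Let Sigu := posdefmx_unit Sigpd.

(** The Woodbury formula, checked as a right inverse of [St] by substituting P^T S^-1 P = L -
    Sig^-1. *)
Lemma marginal_cov_inv :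
  invmx St = invmx S - invmx S *m P *m invmx L *m P^T *m invmx S.
Proof.
set W := RHS.
have Stu : St \in unitmx := posdefmx_unit (posdefmxD_congr P Spd Sigpd).
suff StW : St *m W = 1%:M by rewrite -[RHS](mulKmx Stu) StW mulmx1.
have PSP : P^T *m invmx S *m P = L - invmx Sig by rewrite /L /posterior_precision addrC addKr.
have E : P *m Sig *m P^T *m invmx S *m P *m invmx L *m P^T *m invmx S =
   P *m Sig *m P^T *m invmx S - P *m invmx L *m P^T *m invmx S.
  rewrite -(mulmxA (P *m Sig)) -(mulmxA (P *m Sig)) PSP mulmxBr.
  by rewrite (mulmxK Sigu) !mulmxBl (mulmxK Lu) !mulmxA.
rewrite /W /St mulmxDl !mulmxBr (mulmxV Su) !mulmxA (mulmxV Su) mul1mx E.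
by rewrite opprB [X in _ + X]addrC subrK subrK.
Qed.

(** With e = u - P mu - q and z = x - mu, the joint exponent of (x, u) is regrouped as that of x
    given u plus that of u alone. *)
Lemma complete_square (e : 'cV[R]_m) (z : 'cV[R]_n) :
  qform (invmx S) (e - P *m z) + qform (invmx Sig) z =
  qform L (z - posterior_gain *m e) + qform (invmx St) e.
Proof.
have ST : (invmx S)^T = invmx S by rewrite trmx_inv Spd.1.
have LT : L^T = L := posterior_precision_posdef.1.
have LiT : (invmx L)^T = invmx L by rewrite trmx_inv LT.
have GT : posterior_gain^T = invmx S *m P *m invmx L.
  by rewrite /posterior_gain !trmx_mul trmxK ST LiT mulmxA.
have -> : qform (invmx Sig) z = qform L z - (z^T *m P^T *m invmx S *m P *m z) 0 0.
  rewrite /qform {1}/L /posterior_precision mulmxDr mulmxDl !mulmxA.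
  move: (_ *m invmx Sig *m z) (_ *m P *m z) => A B.
  by rewrite mxE addrK.
have zGT : (z - posterior_gain *m e)^T = z^T - e^T *m (invmx S *m P *m invmx L).
  by rewrite linearB /= -GT -trmx_mul.
have ePT : (e - P *m z)^T = e^T - z^T *m P^T by rewrite linearB /= trmx_mul.
rewrite marginal_cov_inv /qform zGT ePT.
rewrite !(mulmxBr, mulmxBl) /posterior_gain -/L !mulmxA.
rewrite !(mulmxKV Lu) (mulmxK Lu).
move: (e^T *m _ *m e) (e^T *m _ *m P *m z) (z^T *m L *m z) => A B C.
move: (z^T *m P^T *m invmx S *m e) (z^T *m P^T *m _ *m P *m z) => D E.
move: (_ *m e) => F.
rewrite !mxE; ring.
Qed.

(** Factoring out S leaves 1 + S^-1 P Sig P^T, which Sylvester's identity exchanges for 1 + Sig P^T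
    S^-1 P = Sig L. *)
Lemma det_marginal_cov : \det St = \det S * \det Sig * \det L.
Proof.
have -> : St = S *m (1%:M + invmx S *m P *m (Sig *m P^T)).
  by rewrite mulmxDr mulmx1 !mulmxA (mulmxV Su) mul1mx.
rewrite det_mulmx det1D_mulmxC -mulrA -[\det Sig * _]det_mulmx; congr (_ * \det _).
by rewrite /L /posterior_precision mulmxDr (mulmxV Sigu) !mulmxA.
Qed.

End completing_the_square.
End quadratic_forms.

(** * Gaussian integrals *)

Section lebesgue_colvec_integral.
Local Open Scope ereal_scope.
Context {R : realType}.

(** The image of Lebesgue measure under the translation gives every interval its length, which
    characterizes Lebesgue measure. *)
Lemma ge0_integral_lebesgue_shift (c : R) (f : measurableTypeR R -> \bar R) :
  measurable_fun setT f -> (forall x, 0 <= f x) ->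
  \int[lebesgue_measure]_x f (x + c)%R = \int[lebesgue_measure]_x f x.
Proof.
move=> mf f0.
have mphi : measurable_fun setT ((fun x => x + c)%R : measurableTypeR R -> measurableTypeR R).
  exact: measurable_funD.
pose phi : {mfun measurableTypeR R >-> measurableTypeR R} :=
  HB.pack ((fun x => x + c)%R : measurableTypeR R -> measurableTypeR R)
    (isMeasurableFun.Build _ _ _ _ _ mphi).
transitivity (\int[pushforward lebesgue_measure phi]_x f x).
  by rewrite ge0_integral_pushforward.
apply: eq_measure_integral => /= A mA _; apply/esym/lebesgue_measure_unique => //.
move=> _ [[a b]] _ <-; rewrite /pushforward /=.
rewrite [X in _ = lebesgue_measure X](_ : _ = `](a - c)%R, (b - c)%R]%classic);
  last by apply/seteqP; split => x /=; rewrite !in_itv/= ltrBlDr lerBrDr.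
rewrite !lebesgue_measure_itv/= !lte_fin ltrD2r -!EFinB.
by case: ifP => // _; congr EFin; ring.
Qed.

Lemma ge0_integral_lebesgue_colvec0 (f : 'cV[R]_0 -> \bar R) :
  measurable_fun setT f -> (forall x, 0 <= f x) ->
  \int[lebesgue_colvec 0]_x f x = f 0%R.
Proof. by move=> mf f0; rewrite integral_dirac// diracT mul1e. Qed.

Lemma ge0_integral_lebesgue_colvecS n (f : 'cV[R]_n.+1 -> \bar R) :
  measurable_fun setT f -> (forall x, 0 <= f x) ->
  \int[lebesgue_colvec n.+1]_x f x =
  \int[lebesgue_colvec n]_y \int[lebesgue_measure]_z f (colvec_cons (z, y)).
Proof.
move=> mf f0.
have mfc := measurableT_comp mf (@measurable_colvec_cons R n).
transitivity (\int[lebesgue_measure \x lebesgue_colvec n]_z (f \o @colvec_cons R n) z).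
  exact: (ge0_integral_pushforward (@measurable_colvec_cons R n)).
by rewrite fubini_tonelli2// => z; exact: f0.
Qed.

Lemma measurable_colvec_addr n (c : 'cV[R]_n) :
  measurable_fun setT (fun x : 'cV[R]_n => x + c)%R.
Proof.
apply/measurable_fun_colvecP => i; under eq_fun do rewrite mxE.
apply: measurable_funD => //; exact: measurable_colvec_coord.
Qed.

Lemma ge0_integral_lebesgue_colvec_shift n (c : 'cV[R]_n) (f : 'cV[R]_n -> \bar R) :
  measurable_fun setT f -> (forall x, 0 <= f x) ->
  \int[lebesgue_colvec n]_x f (x + c)%R = \int[lebesgue_colvec n]_x f x.
Proof.
elim: n c f => [|n IH] c f mf f0.
  rewrite !ge0_integral_lebesgue_colvec0//; last first.
    exact: measurableT_comp (measurable_colvec_addr c).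
  by congr (f _); exact: flatmx0.
have mfc := measurableT_comp mf (@measurable_colvec_cons R n).
rewrite !ge0_integral_lebesgue_colvecS//; last first.
  exact: measurableT_comp (measurable_colvec_addr c).
pose c' : 'cV[R]_n := \col_j c (lift 0%R j) 0%R.
have E z y : (colvec_cons (z, y) + c = colvec_cons (z + c 0 0, y + c'))%R.
  apply/colP => i; rewrite [LHS]mxE; case: (unliftP 0%R i) => [j|] ->.
    by rewrite !colvec_consS !mxE.
  by rewrite !colvec_cons0.
under eq_integral do under eq_integral do rewrite E.
have mfy y : measurable_fun setT (fun z => f (colvec_cons (z, y))).
  exact: (measurableT_comp mfc (measurable_pair2 y)).
under eq_integral => y _.
  rewrite (@ge0_integral_lebesgue_shift _ (fun z => f (colvec_cons (z, y + c')%R)))//.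
  over.
apply: (IH c' (fun y => \int[lebesgue_measure]_z f (colvec_cons (z, y)))).
  by apply: (measurable_fun_fubini_tonelli_G (f \o @colvec_cons R n)) => // z; exact: f0.
by move=> y; exact: integral_ge0.
Qed.

End lebesgue_colvec_integral.

Section measurable_colvec_ops.
Context {R : realType} d (S : measurableType d).

Lemma measurable_colvecD n (f g : S -> 'cV[R]_n) :
  measurable_fun setT f -> measurable_fun setT g ->
  measurable_fun setT (fun s => f s + g s).
Proof.
move=> /measurable_fun_colvecP mf /measurable_fun_colvecP mg.
apply/measurable_fun_colvecP => i; under eq_fun do rewrite mxE.
exact: measurable_funD.
Qed.

Lemma measurable_colvecN n (f : S -> 'cV[R]_n) :
  measurable_fun setT f -> measurable_fun setT (fun s => - f s).
Proof.
move=> /measurable_fun_colvecP mf.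
apply/measurable_fun_colvecP => i; under eq_fun do rewrite mxE.
exact: measurableT_comp.
Qed.

Lemma measurable_mulmx n m (M : 'M[R]_(m, n)) (f : S -> 'cV[R]_n) :
  measurable_fun setT f -> measurable_fun setT (fun s => M *m f s).
Proof.
move=> /measurable_fun_colvecP mf.
apply/measurable_fun_colvecP => i; under eq_fun do rewrite mxE.
by apply: measurable_sum => j; apply: measurable_funM.
Qed.

Lemma measurable_qform n (M : 'M[R]_n) (f : S -> 'cV[R]_n) :
  measurable_fun setT f -> measurable_fun setT (fun s => qform M (f s)).
Proof.
move=> /measurable_fun_colvecP mf; under eq_fun do rewrite qformE.
apply: measurable_sum => i; apply: measurable_sum => j.
by apply: measurable_funM => //; apply: measurable_funM.
Qed.

Lemma measurable_gaussian_pdf n (Sig : 'M[R]_n) (f g : S -> 'cV[R]_n) :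
  measurable_fun setT f -> measurable_fun setT g ->
  measurable_fun setT (fun s => gaussian_pdf (f s) Sig (g s)).
Proof.
move=> mf mg; apply: measurable_funM => //; apply: measurableT_comp => //.
apply: measurableT_comp => //; apply: measurable_funM => //.
apply: (@measurable_qform n (invmx Sig) (fun s => g s - f s)).
by apply: measurable_colvecD => //; exact: measurable_colvecN.
Qed.
End measurable_colvec_ops.

Section gaussian_integrals.
Local Open Scope ereal_scope.
Context {R : realType}.

(** The normal density of mean -c and variance 1/a has integral 1; its peak is the inverse of the
    announced value. *)
Lemma integral_exp_sqr (a c : R) : (0 < a)%R ->
  \int[lebesgue_measure]_z (expR (- (2^-1 * (a * (z + c) ^+ 2))))%:E =
  (Num.sqrt (2 * pi / a))%:E.
Proof.
move=> a0; pose s := Num.sqrt a^-1.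
have sa : (s ^+ 2 = a^-1)%R by rewrite sqr_sqrtr// invr_ge0 ltW.
have s0 : s != 0%R by rewrite gt_eqF// sqrtr_gt0 invr_gt0.
have := integral_normal_pdf (- c)%R s.
under eq_integral do rewrite (normal_pdfE _ s0) EFinM.
rewrite ge0_integralZl_EFin//; last 3 first.
- by move=> z _; rewrite lee_fin normal_fun_ge0.
- by apply/measurable_EFinP; exact: measurable_normal_fun.
- by rewrite normal_peak_ge0.
move=> /(congr1 (fun z => (Num.sqrt (2 * pi / a))%:E * z)).
rewrite mule1 muleA -EFinM /normal_peak sa.
have -> : (a^-1 * pi *+ 2 = 2 * pi / a :> R)%R by rewrite -mulr_natr; ring.
rewrite divff ?mul1e; last first.
  by rewrite gt_eqF// sqrtr_gt0 divr_gt0// mulr_gt0// pi_gt0.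
move=> <-; apply: eq_integral => z _; rewrite /normal_fun sa opprK.
congr (expR _)%:E; rewrite -mulr_natr; field; lra.
Qed.

(** After translation to the origin, induction on n: for fixed y the first coordinate contributes
    sqrt(2 pi / a), whatever the shift in its square, and the Schur complement remains, with det L =
    a det S. *)
Lemma integral_exp_qform n (L : 'M[R]_n) (mu : 'cV[R]_n) : posdefmx L ->
  \int[lebesgue_colvec n]_x (expR (- (2^-1 * qform L (x - mu))))%:E =
  (Num.sqrt ((2 * pi) ^+ n / \det L))%:E.
Proof.
have mq k (M : 'M[R]_k) :
    measurable_fun setT (fun x : 'cV[R]_k => (expR (- (2^-1 * qform M x)))%:E).
  apply/measurable_EFinP; apply: measurableT_comp => //; apply: measurableT_comp => //.
  by apply: measurable_funM => //; apply: measurable_qform.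
have e0 (t : R) : 0 <= (expR t)%:E by rewrite lee_fin expR_ge0.
move=> Lpd.
rewrite (@ge0_integral_lebesgue_colvec_shift _ _ (- mu)%R
  (fun x => (expR (- (2^-1 * qform L x)))%:E))//.
elim: n L Lpd {mu} => [|n IH] L Lpd.
  rewrite ge0_integral_lebesgue_colvec0// qform0 mulr0 oppr0 expR0.
  by rewrite det_mx00 expr0 divr1 sqrtr1.
rewrite ge0_integral_lebesgue_colvecS//.
have [a0 Spd detL qE] := @posdefmx_schur _ n L Lpd.
set a := L 0%R 0%R in a0 detL qE; set S := (drsubmx _ - _)%R in Spd detL qE.
set b := ursubmx _ in qE.
have E y : \int[lebesgue_measure]_z
    (expR (- (2^-1 * qform L (colvec_cons (z, y)))))%:E =
    (Num.sqrt (2 * pi / a))%:E * (expR (- (2^-1 * qform S y)))%:E.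
  under eq_integral do rewrite qE/= mulrDr opprD expRD EFinM.
  rewrite ge0_integralZr//; last first.
    apply/measurable_EFinP; apply: measurableT_comp => //; apply: measurableT_comp => //.
    apply: measurable_funM => //; apply: measurable_funM => //.
    by apply: measurable_funX; apply: measurable_funD.
  by rewrite integral_exp_sqr.
under eq_integral do rewrite E.
rewrite ge0_integralZl_EFin//; last exact: (mq n S).
rewrite (IH S Spd) -EFinM -sqrtrM; last first.
  by rewrite ltW// divr_gt0// mulr_gt0// pi_gt0.
congr (Num.sqrt _)%:E; rewrite detL exprS.
have := posdefmx_det_gt0 Spd; move: (\det S) => D D0.
by field; rewrite !gt_eqF.
Qed.

Definition gaussian_const n (Sig : 'M[R]_n) := Num.sqrt ((2 * pi) ^+ n * \det Sig).

Lemma gaussian_const_gt0 n (Sig : 'M[R]_n) : posdefmx Sig -> (0 < gaussian_const Sig)%R.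
Proof.
move=> Spd; rewrite sqrtr_gt0 mulr_gt0 ?posdefmx_det_gt0// exprn_gt0//.
by rewrite mulr_gt0// pi_gt0.
Qed.

Lemma gaussian_pdfE n (mu : 'cV[R]_n) Sig x :
  (gaussian_pdf mu Sig x =
   (gaussian_const Sig)^-1 * expR (- (2^-1 * qform (invmx Sig) (x - mu))))%R.
Proof. by []. Qed.

Lemma gaussian_pdf_gt0 n (mu : 'cV[R]_n) Sig x : posdefmx Sig ->
  (0 < gaussian_pdf mu Sig x)%R.
Proof.
by move=> Spd; rewrite gaussian_pdfE mulr_gt0 ?expR_gt0// invr_gt0 gaussian_const_gt0.
Qed.

Lemma integral_gaussian_pdf n (mu : 'cV[R]_n) Sig : posdefmx Sig ->
  \int[lebesgue_colvec n]_x (gaussian_pdf mu Sig x)%:E = 1.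
Proof.
move=> Spd; under eq_integral do rewrite gaussian_pdfE EFinM.
have C0 := gaussian_const_gt0 Spd.
rewrite ge0_integralZl_EFin//; last 2 first.
- apply/measurable_EFinP; apply: measurableT_comp => //; apply: measurableT_comp => //.
  apply: measurable_funM => //; apply: measurable_qform.
  exact: measurable_colvec_addr.
- by rewrite invr_ge0 ltW.
rewrite (integral_exp_qform _ (posdefmx_inv Spd)) -EFinM det_inv invrK.
by rewrite mulVf// gt_eqF.
Qed.

(** By [complete_square] the product, as a function of x, is a constant times an unnormalized
    Gaussian of precision [L]. Integrating it leaves the marginal exponent, and the determinant
    formula reconciles the constants. *)
Lemma gaussian_marginal n m (S : 'M[R]_m) (Sig : 'M[R]_n) (P : 'M[R]_(m, n))
    (q : 'cV[R]_m) (mu : 'cV[R]_n) (u : 'cV[R]_m) :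
  posdefmx S -> posdefmx Sig ->
  \int[lebesgue_colvec n]_x
     ((gaussian_pdf (P *m x + q) S u)%:E * (gaussian_pdf mu Sig x)%:E) =
  (gaussian_pdf (P *m mu + q) (S + P *m Sig *m P^T) u)%:E.
Proof.
move=> Spd Sigpd; have Lpd := posterior_precision_posdef P Spd Sigpd.
set L := posterior_precision S Sig P in Lpd.
pose e := (u - (P *m mu + q))%R; pose G := posterior_gain S Sig P.
set St := (S + _)%R.
have Stpd : posdefmx St by exact: posdefmxD_congr.
have S0 := gaussian_const_gt0 Spd; have Sig0 := gaussian_const_gt0 Sigpd.
have E x : ((gaussian_pdf (P *m x + q) S u)%:E * (gaussian_pdf mu Sig x)%:E =
    ((gaussian_const S)^-1 * (gaussian_const Sig)^-1 *
      expR (- (2^-1 * qform (invmx St) e)))%:E *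
    (expR (- (2^-1 * qform L (x - (mu + G *m e)))))%:E).
  rewrite !gaussian_pdfE -!EFinM; congr EFin.
  rewrite mulrACA -!mulrA -!expRD; congr (_ * (_ * expR _))%R.
  have := complete_square P Spd Sigpd e (x - mu); rewrite -/L -/G -/St.
  have -> : (e - P *m (x - mu) = u - (P *m x + q))%R.
    rewrite /e mulmxBr; move: (P *m mu) (P *m x) => a b.
    by apply/colP => i; rewrite !mxE; ring.
  have -> : (x - mu - G *m e = x - (mu + G *m e))%R by rewrite opprD addrA.
  lra.
under eq_integral do rewrite E.
rewrite ge0_integralZl_EFin//; last 2 first.
- apply/measurable_EFinP; apply: measurableT_comp => //; apply: measurableT_comp => //.
  apply: measurable_funM => //; apply: measurable_qform.
  exact: measurable_colvec_addr.
- by rewrite !mulr_ge0 ?expR_ge0// invr_ge0 ltW.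
rewrite integral_exp_qform// -EFinM gaussian_pdfE; congr EFin.
rewrite mulrAC; congr (_ * _)%R.
have pi2 k : (0 < (2 * pi) ^+ k :> R)%R by rewrite exprn_gt0// mulr_gt0// pi_gt0.
have L0 := posdefmx_det_gt0 Lpd.
(* [k] is the mass sqrt((2 pi)^n / det L) of the unnormalized Gaussian in x. *)
set k := Num.sqrt _.
have k0 : (0 < k)%R by rewrite sqrtr_gt0 divr_gt0.
have -> : (gaussian_const St = gaussian_const S * gaussian_const Sig / k)%R.
  apply/(mulIf (lt0r_neq0 k0)); rewrite divfK ?gt_eqF//.
  rewrite -!sqrtrM ?mulr_ge0 ?exprn_ge0 ?mulr_ge0 ?pi_ge0 ?ltW ?posdefmx_det_gt0//.
  congr Num.sqrt; rewrite (det_marginal_cov P Spd Sigpd) -/L.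
  by field; rewrite gt_eqF.
by rewrite invfM invrK invfM.
Qed.

End gaussian_integrals.

(** * Conditional densities and the closed loop *)

Section density_measure.
Local Open Scope ereal_scope.
Context d (S : measurableType d) (R : realType).
Variables (mu : {measure set S -> \bar R}) (g : S -> R).

(* The two proofs are arguments so that the measure structure can be inferred. *)
Definition density_measure of measurable_fun setT g & (forall x, (0 <= g x)%R) :=
  fun A : set S => \int[mu]_(x in A) (g x)%:E.

Variables (mg : measurable_fun setT g) (g0 : forall x, (0 <= g x)%R).

Let density_measure0 : density_measure mg g0 set0 = 0.
Proof. exact: integral_set0. Qed.

Let density_measure_ge0 A : 0 <= density_measure mg g0 A.
Proof. by apply: integral_ge0 => x _; rewrite lee_fin. Qed.

Let density_measure_sigma_additive : semi_sigma_additive (density_measure mg g0).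
Proof.
move=> F mF tF mUF; rewrite /density_measure ge0_integral_bigcup//.
- apply: is_cvg_ereal_nneg_natsum_cond => n _ _.
  by apply: integral_ge0 => x _; rewrite lee_fin.
- by apply: measurable_funTS; exact/measurable_EFinP.
- by move=> x _; rewrite lee_fin.
Qed.

HB.instance Definition _ := isMeasure.Build _ _ _ (density_measure mg g0)
  density_measure0 density_measure_ge0 density_measure_sigma_additive.

End density_measure.

Section product_density.
Local Open Scope ereal_scope.
Context d1 d2 (E : measurableType d1) (U : measurableType d2) (R : realType).
Variables (m1 : {sigma_finite_measure set E -> \bar R})
  (m2 : {sigma_finite_measure set U -> \bar R}) (W : probability (E * U)%type R)
  (g : E * U -> R).
Hypotheses (mg : measurable_fun setT g) (g0 : forall z, (0 <= g z)%R).
Hypothesis Wg : forall A D, measurable A -> measurable D ->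
  W (A `*` D) = \int[m1]_(x in A) \int[m2]_(u in D) (g (x, u))%:E.

Let mgE : measurable_fun setT (EFin \o g). Proof. exact/measurable_EFinP. Qed.

(* An alias of [m1 \x m2]: the library only infers its sigma-finiteness when both
   factors are subprobabilities. *)
Let m12 : set (E * U) -> \bar R := m1 \x m2.

HB.instance Definition _ := Measure.on m12.

Let m12_sigma_finite : sigma_finite setT m12.
Proof.
have /sigma_finiteP[F [TF ndF Foo]] := sigma_finiteT m1.
have /sigma_finiteP[G [TG ndG Goo]] := sigma_finiteT m2.
exists (fun k => F k `*` G k).
  apply/esym; rewrite -subTset => -[x y] _.
  have [i _ Fix] : (\bigcup_k F k) x by rewrite -TF.
  have [j _ Gjy] : (\bigcup_k G k) y by rewrite -TG.
  exists (maxn i j) => //; split => /=.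
  - by move: x Fix; exact/subsetPset/ndF/leq_maxl.
  - by move: y Gjy; exact/subsetPset/ndG/leq_maxr.
move=> k; have [mFk Fkoo] := Foo k; have [mGk Gkoo] := Goo k.
split; first exact: measurableX.
by rewrite /m12 product_measure1E// lte_mul_pinfty// ge0_fin_numE.
Qed.

HB.instance Definition _ := Measure_isSigmaFinite.Build _ _ _ m12 m12_sigma_finite.

Let density_rectangle A D : measurable A -> measurable D ->
  W (A `*` D) = density_measure m12 mg g0 (A `*` D).
Proof.
move=> mA mD; rewrite /density_measure integral_mkcond /m12 fubini_tonelli1; last 2 first.
- apply/(measurable_restrictT _ (measurableX mA mD)).
  exact: measurable_funTS.
- by move=> z; rewrite patchE; case: ifP => // _; rewrite lee_fin.
rewrite Wg// [LHS]integral_mkcond; apply: eq_integral => x _.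
rewrite /fubini_F patchE; case: ifPn => xA.
  rewrite [LHS]integral_mkcond; apply: eq_integral => u _.
  by rewrite !patchE in_setX xA.
by rewrite integral0_eq// => u _; rewrite patchE in_setX (negbTE xA).
Qed.

(** Rectangles generate the product sigma-algebra, are stable under intersection and include the
    whole space, on which [W] is finite; agreement on them therefore suffices. *)
Let product_density : has_density W m12 g.
Proof.
pose C : set (set (E * U)) :=
  [set C | exists A, measurable A /\ exists B, measurable B /\ C = A `*` B].
move=> B mB.
apply: (measure_unique C (fun=> setT) _ _ _ _ _ (density_measure m12 mg g0) _ _ B mB).
- rewrite measurable_prod_measurableType //; congr (<<s _ >>).
  rewrite predeqE; split => [[A mA [D mD <-]]|[A [mA [D [mD ->]]]]].
    by exists A; split => //; exists D.
  by exists A => //; exists D.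
- move=> /= _ _ [X1 [mX1 [X2 [mX2 ->]]]] [Y1 [mY1 [Y2 [mY2 ->]]]].
  rewrite -setXI; exists (X1 `&` Y1); split; first exact: measurableI.
  by exists (X2 `&` Y2); split => //; exact: measurableI.
- move=> _; exists setT; split => //; exists setT; split => //.
  by rewrite setXTT.
- by rewrite bigcup_const.
- by move=> _ [A [mA [D [mD ->]]]]; exact: density_rectangle.
- by move=> _; apply: (@le_lt_trans _ _ 1); [exact: probability_le1|exact: ltry].
Qed.

Lemma ge0_integral_product_density (f : E * U -> \bar R) :
  measurable_fun setT f -> (forall z, 0 <= f z) ->
  \int[W]_z f z = \int[m1]_x \int[m2]_u (f (x, u) * (g (x, u))%:E).
Proof.
move=> mf f0; rewrite (ge0_integral_density mg g0 product_density mf f0).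
rewrite /m12 fubini_tonelli1//; first exact: emeasurable_funM.
by move=> z; rewrite mule_ge0// lee_fin.
Qed.

End product_density.

Section conditional_density.
Local Open Scope ereal_scope.
Context d d1 d2 (Om : measurableType d) (E : measurableType d1)
  (U : measurableType d2) (R : realType) (Pr : probability Om R).
Variables (X : {RV Pr >-> E}) (Y : {RV Pr >-> U}).
Variables (mu : {sigma_finite_measure set U -> \bar R}) (g : E * U -> R).

(** The conditional law of [Y] given [X] has density [g (X, .)], tested on rectangles. The outer
    integral stays on [Om], so that [X] itself may be without a density. *)
Definition has_cond_density := forall A D, measurable A -> measurable D ->
  Pr (X @^-1` A `&` Y @^-1` D) =
  \int[Pr]_(om in X @^-1` A) \int[mu]_(u in D) (g (X om, u))%:E.

Hypotheses (mg : measurable_fun setT g) (g0 : forall z, (0 <= g z)%R).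
Hypothesis XYg : has_cond_density.

(** The joint law has density [g] with respect to the product of the law of [X] and [mu]. *)
Lemma integral_cond_density (f : E * U -> \bar R) :
  measurable_fun setT f -> (forall z, 0 <= f z) ->
  \int[Pr]_om f (X om, Y om) =
  \int[Pr]_om \int[mu]_u (f (X om, u) * (g (X om, u))%:E).
Proof.
move=> mf f0.
have mXY : measurable_fun setT (fun om => (X om, Y om)).
  by apply/measurable_fun_pairP; split => /=; exact: measurable_funPT.
pose XY : {mfun Om >-> (E * U)%type} :=
  HB.pack (fun om => (X om, Y om)) (isMeasurableFun.Build _ _ _ _ _ mXY).
have mgE : measurable_fun setT (EFin \o g) by exact/measurable_EFinP.
have F_ge0 h (x : E) : (forall z, 0 <= h z) -> 0 <= \int[mu]_u h (x, u).
  by move=> h0; apply: integral_ge0.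
transitivity (\int[distribution Pr XY]_z f z).
  by rewrite ge0_integral_distribution.
rewrite (ge0_integral_product_density (m1 := distribution Pr X) (m2 := mu) mg g0)//.
- rewrite ge0_integral_distribution//.
  + apply: (measurable_fun_fubini_tonelli_F (fun z => f z * (g z)%:E)).
      exact: emeasurable_funM.
    by move=> z; rewrite mule_ge0// lee_fin.
  + by move=> x; apply: (F_ge0 (fun z => f z * (g z)%:E)) => z; rewrite mule_ge0// lee_fin.
- move=> A D mA mD; rewrite ge0_integral_pushforward//.
  + by rewrite -XYg.
  + apply: measurable_funTS.
    rewrite (_ : (fun x => _) = fubini_F mu ((EFin \o g) \_ (setT `*` D))).
      apply: measurable_fun_fubini_tonelli_F.
        apply/(measurable_restrictT _ (measurableX measurableT mD)).
        exact: measurable_funTS.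
      by move=> z; rewrite patchE; case: ifP => // _; rewrite lee_fin.
    apply/funext => x; rewrite /fubini_F [LHS]integral_mkcond.
    by apply: eq_integral => u _; rewrite !patchE in_setX in_setT.
  + by move=> x _; apply: integral_ge0 => u _; rewrite lee_fin.
Qed.

End conditional_density.

Section gaussian_laws.
Local Open Scope ereal_scope.
Context {R : realType} d (Om : measurableType d) (Pr : probability Om R).

Lemma measurable_gaussian_pdfr n (mu : 'cV[R]_n) Sig :
  measurable_fun setT (gaussian_pdf mu Sig).
Proof. exact: measurable_gaussian_pdf. Qed.

Lemma ge0_integral_gaussian_law n (X : {RV Pr >-> 'cV[R]_n}) mu Sig :
  posdefmx Sig -> same_law (distribution Pr X) (gaussian mu Sig) ->
  forall f : 'cV[R]_n -> \bar R, measurable_fun setT f -> (forall x, 0 <= f x) ->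
  \int[Pr]_om f (X om) =
  \int[lebesgue_colvec n]_x (f x * (gaussian_pdf mu Sig x)%:E).
Proof.
move=> Spd XL f mf f0.
have p0 x : (0 <= gaussian_pdf mu Sig x)%R by rewrite ltW// gaussian_pdf_gt0.
rewrite -(ge0_integral_density (measurable_gaussian_pdfr mu Sig) p0 XL)//.
by rewrite ge0_integral_distribution.
Qed.

Lemma gaussian_law_integral n (X : {RV Pr >-> 'cV[R]_n}) mu Sig :
  (forall f : 'cV[R]_n -> \bar R, measurable_fun setT f -> (forall x, 0 <= f x) ->
    \int[Pr]_om f (X om) =
    \int[lebesgue_colvec n]_x (f x * (gaussian_pdf mu Sig x)%:E)) ->
  same_law (distribution Pr X) (gaussian mu Sig).
Proof.
move=> H D mD; rewrite /gaussian integral_mkcond.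
have := H (EFin \o \1_D).
have mXD : measurable (X @^-1` D) by rewrite -[X in measurable X]setTI; exact: measurable_funPT.
have -> : \int[Pr]_om (EFin \o \1_D) (X om) = distribution Pr X D.
  transitivity (\int[Pr]_om (\1_(X @^-1` D) om)%:E); first by [].
  by rewrite integral_indic// setIT.
move=> ->; last 2 first.
- by apply/measurable_EFinP; exact: measurable_indic.
- by move=> x; rewrite lee_fin.
apply: eq_integral => x _; rewrite patchE /= indicE.
by case: ifP => _; rewrite ?mul1e ?mul0e.
Qed.

(** Tonelli brings the integral over x inside, where it is the one computed by
    [gaussian_marginal]. *)
Lemma gaussian_law_marginal n m (X : {RV Pr >-> 'cV[R]_n}) (Y : {RV Pr >-> 'cV[R]_m})
    mu Sig S (P : 'M[R]_(m, n)) q :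
  posdefmx Sig -> posdefmx S ->
  same_law (distribution Pr X) (gaussian mu Sig) ->
  has_cond_density X Y (lebesgue_colvec m)
    (fun z => gaussian_pdf (P *m z.1 + q) S z.2) ->
  same_law (distribution Pr Y) (gaussian (P *m mu + q) (S + P *m Sig *m P^T)).
Proof.
move=> Sigpd Spd XL XY; apply: gaussian_law_integral => f mf f0.
have mg : measurable_fun setT (fun z : 'cV[R]_n * 'cV[R]_m =>
    gaussian_pdf (P *m z.1 + q) S z.2).
  apply: measurable_gaussian_pdf => //; apply: measurable_colvecD => //.
  exact: measurable_mulmx.
have g0 (z : 'cV[R]_n * 'cV[R]_m) : (0 <= gaussian_pdf (P *m z.1 + q) S z.2)%R.
  by rewrite ltW// gaussian_pdf_gt0.
have mf2 : measurable_fun setT (fun z : 'cV[R]_n * 'cV[R]_m => f z.2).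
  exact: measurableT_comp.
rewrite (integral_cond_density mg g0 XY (f := fun z => f z.2))//.
have p0 x : (0 <= gaussian_pdf mu Sig x)%R by rewrite ltW// gaussian_pdf_gt0.
pose H x := \int[lebesgue_colvec m]_u (f u * (gaussian_pdf (P *m x + q) S u)%:E).
have mfg : measurable_fun setT (fun z : 'cV[R]_n * 'cV[R]_m =>
    f z.2 * (gaussian_pdf (P *m z.1 + q) S z.2)%:E).
  by apply: emeasurable_funM => //; exact/measurable_EFinP.
have mH : measurable_fun setT H.
  apply: (measurable_fun_fubini_tonelli_F (fun z : 'cV[R]_n * 'cV[R]_m =>
    f z.2 * (gaussian_pdf (P *m z.1 + q) S z.2)%:E)) => //.
  by move=> z; rewrite mule_ge0// lee_fin.
rewrite (ge0_integral_gaussian_law Sigpd XL (f := H))//; last first.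
  by move=> x; apply: integral_ge0 => u _; rewrite mule_ge0// lee_fin (g0 (x, u)).
pose F (z : 'cV[R]_n * 'cV[R]_m) :=
  f z.2 * (gaussian_pdf (P *m z.1 + q) S z.2)%:E * (gaussian_pdf mu Sig z.1)%:E.
have mF : measurable_fun setT F.
  apply: emeasurable_funM => //; apply/measurable_EFinP.
  exact: measurable_gaussian_pdf.
have F0 z : 0 <= F z by rewrite !mule_ge0// lee_fin.
transitivity (\int[lebesgue_colvec n]_x \int[lebesgue_colvec m]_u F (x, u)).
  apply: eq_integral => x _; rewrite /H /F/= ge0_integralZr//.
  - exact: (measurableT_comp mfg (measurable_pair1 x)).
  - by move=> u _; rewrite mule_ge0// lee_fin (g0 (x, u)).
  - by rewrite lee_fin.
rewrite fubini_tonelli//; apply: eq_integral => u _.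
rewrite /F/=; under eq_integral do rewrite -muleA.
rewrite ge0_integralZl//.
- by rewrite gaussian_marginal.
- apply: emeasurable_funM; apply/measurable_EFinP => //.
    exact: (measurableT_comp mg (measurable_pair2 u)).
  exact: measurable_gaussian_pdfr.
- by move=> x _; rewrite mule_ge0// lee_fin; [exact: (g0 (x, u))|exact: p0].
Qed.

(** [Z] may be degenerate, so the noise is integrated first: at y the next state has density
    E[gaussian_pdf(Z, Sw, y)]. Then [gaussian_marginal] is used twice, to average over the input
    given the state, with matrix [B], and over the state, with matrix [A + B *m P]. *)
Lemma gaussian_law_step n m (X X' Z W : {RV Pr >-> 'cV[R]_n}) (Y : {RV Pr >-> 'cV[R]_m})
    mu Sig S Sw (P : 'M[R]_(m, n)) q A (B : 'M[R]_(n, m)) :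
  posdefmx Sig -> posdefmx S -> posdefmx Sw ->
  same_law (distribution Pr X) (gaussian mu Sig) ->
  has_cond_density X Y (lebesgue_colvec m)
    (fun z => gaussian_pdf (P *m z.1 + q) S z.2) ->
  (forall om, Z om = A *m X om + B *m Y om)%R ->
  has_cond_density Z W (lebesgue_colvec n) (fun z => gaussian_pdf 0 Sw z.2) ->
  (forall om, X' om = Z om + W om)%R ->
  same_law (distribution Pr X') (gaussian ((A + B *m P) *m mu + B *m q)
    ((A + B *m P) *m Sig *m (A + B *m P)^T + B *m S *m B^T + Sw)).
Proof.
move=> Sigpd Spd Swpd XL XY ZE ZW X'E.
apply: gaussian_law_integral => f mf f0.
have mg : measurable_fun setT (fun z : 'cV[R]_n * 'cV[R]_m =>
    gaussian_pdf (P *m z.1 + q) S z.2).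
  apply: measurable_gaussian_pdf => //; apply: measurable_colvecD => //.
  exact: measurable_mulmx.
have g0 (z : 'cV[R]_n * 'cV[R]_m) : (0 <= gaussian_pdf (P *m z.1 + q) S z.2)%R.
  by rewrite ltW// gaussian_pdf_gt0.
have mgw : measurable_fun setT (fun z : 'cV[R]_n * 'cV[R]_n => gaussian_pdf 0 Sw z.2).
  exact: measurable_gaussian_pdf.
have gw0 (z : 'cV[R]_n * 'cV[R]_n) : (0 <= gaussian_pdf 0 Sw z.2)%R.
  by rewrite ltW// gaussian_pdf_gt0.
under eq_integral do rewrite X'E.
have mfD : measurable_fun setT (fun z : 'cV[R]_n * 'cV[R]_n => f (z.1 + z.2)%R).
  by apply: measurableT_comp => //; exact: measurable_colvecD.
rewrite (integral_cond_density mgw gw0 ZW (f := fun z => f (z.1 + z.2)%R))//.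
pose F (z : Om * 'cV[R]_n) := f z.2 * (gaussian_pdf (Z z.1) Sw z.2)%:E.
have mF : measurable_fun setT F.
  apply: emeasurable_funM; first exact: measurableT_comp.
  apply/measurable_EFinP; apply: measurable_gaussian_pdf => //.
  exact: (measurableT_comp (measurable_funPT Z) measurable_fst).
have F0 z : 0 <= F z by rewrite mule_ge0// lee_fin ltW// gaussian_pdf_gt0.
transitivity (\int[Pr]_om \int[lebesgue_colvec n]_y F (om, y)).
  apply: eq_integral => om _.
  have mFom : measurable_fun setT (fun y => F (om, y)).
    exact: (measurableT_comp mF (measurable_pair1 om)).
  have Fom0 y : 0 <= F (om, y) by exact: F0.
  (* Translation by [Z om] turns the centred noise density into one centred at [Z om], with y now
     standing for the next state. *)
  apply: etrans (ge0_integral_lebesgue_colvec_shift (Z om) mFom Fom0).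
  apply: eq_integral => y _; rewrite /F/= addrC; congr (_ * _%:E).
  by rewrite /gaussian_pdf subr0 addrK.
rewrite fubini_tonelli//; apply: eq_integral => y _.
rewrite /F/= ge0_integralZl//; last 2 first.
- apply/measurable_EFinP; exact: measurable_gaussian_pdf.
- by move=> om _; rewrite lee_fin ltW// gaussian_pdf_gt0.
congr (_ * _).
under eq_integral do rewrite ZE.
pose G (z : 'cV[R]_n * 'cV[R]_m) := (gaussian_pdf (A *m z.1 + B *m z.2) Sw y)%:E.
have mG : measurable_fun setT G.
  apply/measurable_EFinP; apply: measurable_gaussian_pdf => //.
  by apply: measurable_colvecD => //; exact: measurable_mulmx.
rewrite (integral_cond_density mg g0 XY (f := G))//; last first.
  by move=> z; rewrite lee_fin ltW// gaussian_pdf_gt0.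
have BSBpd : posdefmx (Sw + B *m S *m B^T) by exact: posdefmxD_congr.
pose H x := (gaussian_pdf ((A + B *m P) *m x + B *m q) (Sw + B *m S *m B^T) y)%:E.
transitivity (\int[Pr]_om H (X om)).
  apply: eq_integral => om _; rewrite /G/=.
  under eq_integral do rewrite addrC.
  rewrite (gaussian_marginal B (A *m X om) (P *m X om + q) y Swpd Spd) /H.
  have -> // : (B *m (P *m X om + q) + A *m X om = (A + B *m P) *m X om + B *m q)%R.
  by rewrite mulmxDr mulmxDl mulmxA addrAC [X in (X + _)%R]addrC.
rewrite (ge0_integral_gaussian_law Sigpd XL (f := H)); last 2 first.
- apply/measurable_EFinP; apply: measurable_gaussian_pdf => //.
  by apply: measurable_colvecD => //; exact: measurable_mulmx.
- by move=> x; rewrite lee_fin ltW// gaussian_pdf_gt0.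
rewrite /H (gaussian_marginal (A + B *m P) (B *m q) mu y BSBpd Sigpd).
have -> // : (Sw + B *m S *m B^T + (A + B *m P) *m Sig *m (A + B *m P)^T =
  (A + B *m P) *m Sig *m (A + B *m P)^T + B *m S *m B^T + Sw)%R.
by rewrite addrC -addrA; congr (_ + _)%R; rewrite addrC.
Qed.

End gaussian_laws.

Section closed_loop_laws.
Context {R : realType} (T n m : nat).
Variables (mu_ini : 'cV[R]_n) (Sigma_ini : 'M[R]_n)
  (A : 'I_T -> 'M[R]_n) (B : 'I_T -> 'M[R]_(n, m)) (Sigma_w : 'I_T -> 'M[R]_n).
Hypotheses (hSigma_w : forall k, posdefmx (Sigma_w k))
  (hSigma_ini : posdefmx Sigma_ini).
Variables (P : 'I_T -> 'M[R]_(m, n)) (q : 'I_T -> 'cV[R]_m)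
  (Sigma_pi : 'I_T -> 'M[R]_m).
Hypothesis hSigma_pi : forall k, posdefmx (Sigma_pi k).
Variable pi : 'I_T -> R.-pker 'cV[R]_n ~> 'cV[R]_m.
Hypothesis hpi : forall k x, same_law (pi k x) (gaussian (P k *m x + q k) (Sigma_pi k)).
Variables (mu_x : nat -> 'cV[R]_n) (Sigma_x : nat -> 'M[R]_n).
Hypotheses (hmu0 : mu_x 0%N = mu_ini)
  (hmuS : forall k : 'I_T, mu_x k.+1 = (A k + B k *m P k) *m mu_x k + B k *m q k)
  (hSigma0 : Sigma_x 0%N = Sigma_ini)
  (hSigmaS : forall k : 'I_T,
     Sigma_x k.+1 = (A k + B k *m P k) *m Sigma_x k *m (A k + B k *m P k)^T
                    + B k *m Sigma_pi k *m (B k)^T + Sigma_w k).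
Variables (d : measure_display) (Omega : measurableType d) (Pr : probability Omega R)
  (x : nat -> {RV Pr >-> 'cV[R]_n}) (u : 'I_T -> {RV Pr >-> 'cV[R]_m})
  (w : 'I_T -> {RV Pr >-> 'cV[R]_n}).
Hypothesis hcl : closed_loop mu_ini Sigma_ini A B Sigma_w x u w pi.

Let past_state (k : 'I_T) D : measurable D -> past x u w k (x k @^-1` D).
Proof. by move=> mD; left; right; exists D => //; rewrite setTI. Qed.

Lemma closed_loop_input_density (k : 'I_T) :
  has_cond_density (x k) (u k) (lebesgue_colvec m)
    (fun z => gaussian_pdf (P k *m z.1 + q k) (Sigma_pi k) z.2).
Proof.
move=> D E mD mE; rewrite (closed_loop_input hcl)//; last first.
  by apply: sub_sigma_algebra; exact: past_state.
by apply: eq_integral => om _; rewrite hpi.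
Qed.

(** Independence makes the conditional density of the noise constant in [Z]. *)
Lemma closed_loop_noise_density (k : 'I_T) (Z : {RV Pr >-> 'cV[R]_n}) :
  (forall om, Z om = A k *m x k om + B k *m u k om) ->
  has_cond_density Z (w k) (lebesgue_colvec n)
    (fun z => gaussian_pdf 0 (Sigma_w k) z.2).
Proof.
move=> ZE D E mD mE.
have mZD : measurable (Z @^-1` D).
  by rewrite -[X in measurable X]setTI; exact: measurable_funPT.
rewrite (closed_loop_indep hcl)//; last first.
  (* Independence is known only for events generated by the past and u_k; [Z] is measurable for
     them, being linear in x_k and u_k. *)
  set G := (G in <<s G >>).
  have mx : measurable_fun (setT : set (g_sigma_algebraType G)) (x k).
    move=> _ C mC; rewrite setTI; apply: sub_sigma_algebra; left.
    exact: past_state.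
  have mu : measurable_fun (setT : set (g_sigma_algebraType G)) (u k).
    move=> _ C mC; apply: sub_sigma_algebra; right.
    by exists C.
  have := measurable_colvecD (measurable_mulmx (A k) mx) (measurable_mulmx (B k) mu).
  move=> /(_ measurableT _ mD); rewrite setTI.
  by rewrite (_ : (fun s => _) = Z)//; apply/funext => om; rewrite ZE.
have wE : Pr (w k @^-1` E) = gaussian 0 (Sigma_w k) E := closed_loop_noise hcl k mE.
by rewrite wE -/(gaussian _ _ _) integral_cst// muleC.
Qed.

(** Positive definiteness is carried through the induction with the law, since every Gaussian
    computation inverts the covariance; [Sigma_w] keeps it strict even if the dynamics are
    singular. *)
Lemma closed_loop_state_law k : (k <= T)%N ->
  posdefmx (Sigma_x k) /\
  same_law (distribution Pr (x k)) (gaussian (mu_x k) (Sigma_x k)).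
Proof.
elim: k => [_|k IH kT].
  by rewrite hSigma0 hmu0; split => //; exact: closed_loop_init hcl.
have [Spd SL] := IH (ltnW kT); pose k' := Ordinal kT.
rewrite (hmuS k') (hSigmaS k'); split.
  have := posdefmxD_congr (B k') (hSigma_w k') (hSigma_pi k').
  move=> /(posdefmxD_congr (A k' + B k' *m P k'))/(_ Spd).
  by congr posdefmx; rewrite [LHS]addrC -addrA; congr (_ + _); rewrite addrC.
have mZ : measurable_fun setT (fun om => A k' *m x k' om + B k' *m u k' om).
  by apply: measurable_colvecD; apply: measurable_mulmx; exact: measurable_funPT.
pose Z : {RV Pr >-> 'cV[R]_n} :=
  HB.pack (fun om => A k' *m x k' om + B k' *m u k' om)
    (isMeasurableFun.Build _ _ _ _ _ mZ).
have ZE om : Z om = A k' *m x k' om + B k' *m u k' om by [].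
exact: (gaussian_law_step Spd (hSigma_pi k') (hSigma_w k') SL
  (@closed_loop_input_density k') ZE (closed_loop_noise_density ZE)
  (fun om => closed_loop_step hcl k' om)).
Qed.

Lemma closed_loop_input_law (k : 'I_T) :
  same_law (distribution Pr (u k)) (gaussian (P k *m mu_x k + q k)
    (Sigma_pi k + P k *m Sigma_x k *m (P k)^T)).
Proof.
have [Spd SL] := closed_loop_state_law (ltnW (ltn_ord k)).
exact: (gaussian_law_marginal Spd (hSigma_pi k) SL (@closed_loop_input_density k)).
Qed.

End closed_loop_laws.

(** * Second moments of Gaussian laws *)

Section gaussian_moments.
Context {R : realType}.

Lemma qformZ n (a : R) (M : 'M[R]_n) v : qform (a *: M) v = a * qform M v.
Proof. by rewrite /qform -scalemxAr -scalemxAl mxE. Qed.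

Lemma posdefmxZ n (a : R) (M : 'M[R]_n) : 0 < a -> posdefmx M -> posdefmx (a *: M).
Proof.
move=> a0 [MT M0]; split; first by rewrite linearZ /= MT.
by move=> v v0; have := qformZ a M v; rewrite /qform => ->; rewrite mulr_gt0// M0.
Qed.

Lemma qform_mulmx n m (M : 'M[R]_m) (P : 'M[R]_(m, n)) v :
  qform M (P *m v) = qform (P^T *m M *m P) v.
Proof. by rewrite /qform trmx_mul !mulmxA. Qed.

(** Half of the exponential decay absorbs the linear factor, through t <= 4 exp(t/4). *)
Lemma mulr_expRN_le (t : R) : t * expR (- (2^-1 * t)) <= 4 * expR (- (4^-1 * t)).
Proof.
have -> : - (4^-1 * t) = - (2^-1 * t) + 4^-1 * t by field.
rewrite expRD mulrCA mulrC ler_wpM2l ?expR_ge0//.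
by have := expR_ge1Dx (4^-1 * t); lra.
Qed.

Local Open Scope ereal_scope.

(** The form [M] is dominated by a multiple of that of [invmx Sig], split around [mu]. The quadratic
    factor is then absorbed by the exponential at the price of doubling the covariance. *)
Lemma integral_qform_gaussian_lty n (mu c : 'cV[R]_n) (Sig M : 'M[R]_n) :
  posdefmx Sig -> (forall v, (0 <= qform M v)%R) ->
  \int[lebesgue_colvec n]_x ((qform M (x - c))%:E * (gaussian_pdf mu Sig x)%:E) < +oo.
Proof.
move=> Spd M0; have Sipd := posdefmx_inv Spd.
have [K K0 MK] := qform_le_qform_inv M Spd.
(* [a] gathers the domination constant, the 2 of [qformD_le], the normalization and the 4 of
   [mulr_expRN_le]; [b] is the contribution of the offset mu - c. *)
pose a := (K * 2 * (gaussian_const Sig)^-1 * 4)%R.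
pose b := (K * (2 * qform (invmx Sig) (mu - c)))%R.
have C0 := gaussian_const_gt0 Spd.
have a0 : (0 <= a)%R by rewrite !mulr_ge0// invr_ge0 ltW.
have b0 : (0 <= b)%R by rewrite !mulr_ge0// qform_ge0.
have Hpd : posdefmx (2^-1 *: invmx Sig : 'M[R]_n)%R by apply: posdefmxZ.
have msub (e : 'cV[R]_n) : measurable_fun setT (fun x : 'cV[R]_n => x - e)%R.
  exact: measurable_colvec_addr.
have mexp : measurable_fun setT (fun x : 'cV[R]_n =>
    (expR (- (2^-1 * qform (2^-1 *: invmx Sig) (x - mu))))%:E).
  apply/measurable_EFinP; apply: measurableT_comp => //; apply: measurableT_comp => //.
  by apply: measurable_funM => //; exact: measurable_qform.
have mpdf : measurable_fun setT (fun x => (gaussian_pdf mu Sig x)%:E).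
  by apply/measurable_EFinP; exact: measurable_gaussian_pdfr.
have pdf0 x : (0 <= gaussian_pdf mu Sig x)%R by rewrite ltW// gaussian_pdf_gt0.
apply: (@le_lt_trans _ _ (\int[lebesgue_colvec n]_x
    (a%:E * (expR (- (2^-1 * qform (2^-1 *: invmx Sig) (x - mu))))%:E +
     b%:E * (gaussian_pdf mu Sig x)%:E))).
  apply: ge0_le_integral => //.
  - by move=> x _; rewrite mule_ge0// lee_fin.
  - by apply: emeasurable_funM => //; apply/measurable_EFinP; exact: measurable_qform.
  - by apply: emeasurable_funD; exact: measurable_funeM.
  - move=> x _; rewrite -!EFinM -EFinD lee_fin.
    have Q := qformD_le (x - mu)%R (mu - c)%R Sipd.
    have xc : (x - mu + (mu - c) = x - c)%R by rewrite addrA subrK.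
    rewrite xc in Q.
    have := MK (x - c)%R; move: (qform M _) => v vK.
    have {}vK := le_trans vK (ler_wpM2l K0 Q).
    apply: le_trans (ler_wpM2r (pdf0 x) vK) _.
    rewrite mulrDr mulrDl lerD//.
    rewrite gaussian_pdfE qformZ.
    have := mulr_expRN_le (qform (invmx Sig) (x - mu)).
    have -> : (2^-1 * (2^-1 * qform (invmx Sig) (x - mu)) =
      4^-1 * qform (invmx Sig) (x - mu))%R by field.
    have k0 : (0 <= K * 2 * (gaussian_const Sig)^-1)%R.
      by rewrite !mulr_ge0// invr_ge0 ltW.
    move=> /(ler_wpM2l k0); rewrite /a; move: (qform _ (x - mu)%R) => t.
    by congr (_ <= _)%R; ring.
rewrite ge0_integralD//; last 4 first.
- by move=> x _; rewrite mule_ge0// lee_fin ?expR_ge0.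
- exact: measurable_funeM.
- by move=> x _; rewrite mule_ge0// lee_fin.
- exact: measurable_funeM.
rewrite ge0_integralZl_EFin// ge0_integralZl_EFin//; last by move=> x _; rewrite lee_fin.
by rewrite integral_exp_qform// integral_gaussian_pdf// mule1 -EFinM -EFinD ltry.
Qed.

Lemma integral_gaussian_law_qform_lty n d (Om : measurableType d)
    (Pr : probability Om R) (X : {RV Pr >-> 'cV[R]_n}) mu Sig (M : 'M[R]_n) c :
  posdefmx Sig -> (forall v, (0 <= qform M v)%R) ->
  same_law (distribution Pr X) (gaussian mu Sig) ->
  \int[Pr]_om (qform M (X om - c))%:E < +oo.
Proof.
move=> Spd M0 XL.
rewrite (ge0_integral_gaussian_law Spd XL (f := fun x => (qform M (x - c))%:E)).
- exact: integral_qform_gaussian_lty.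
- apply/measurable_EFinP; apply: measurable_qform; exact: measurable_colvec_addr.
- by move=> x; rewrite lee_fin.
Qed.

Lemma ln_gaussian_pdf n (mu : 'cV[R]_n) Sig x : posdefmx Sig ->
  ln (gaussian_pdf mu Sig x) =
  (- ln (gaussian_const Sig) - 2^-1 * qform (invmx Sig) (x - mu))%R.
Proof.
move=> Spd; have C0 := gaussian_const_gt0 Spd.
by rewrite gaussian_pdfE lnM ?posrE ?invr_gt0 ?expR_gt0// lnV ?posrE// expRK.
Qed.

End gaussian_moments.

Lemma integral_abs_lty d (O : measurableType d) (R : realType)
    (p : probability O R) (f s t : O -> R) (K : R) :
  measurable_fun setT f -> measurable_fun setT s -> measurable_fun setT t ->
  (0 <= K)%R -> (forall x, (0 <= s x)%R) -> (forall x, (0 <= t x)%R) ->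
  (forall x, (`|f x| <= K + (s x + t x))%R) ->
  (\int[p]_x (s x)%:E < +oo -> \int[p]_x (t x)%:E < +oo ->
   \int[p]_x `|(f x)%:E| < +oo)%E.
Proof.
move=> mf ms mt K0 s0 t0 fle I1 I2.
have msE : measurable_fun setT (EFin \o s) by exact/measurable_EFinP.
have mtE : measurable_fun setT (EFin \o t) by exact/measurable_EFinP.
apply: (@le_lt_trans _ _ (\int[p]_x (K%:E + ((s x)%:E + (t x)%:E))))%E.
  apply: ge0_le_integral => //.
  - by apply: measurableT_comp => //; exact/measurable_EFinP.
  - by apply: emeasurable_funD => //; exact: emeasurable_funD.
  - by move=> x _; rewrite abse_EFin -!EFinD lee_fin.
rewrite ge0_integralD//; last 2 first.
- by move=> x _; rewrite adde_ge0// lee_fin.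
- exact: emeasurable_funD.
rewrite integral_probability_cst ge0_integralD//; last 2 first.
- by move=> x _; rewrite lee_fin.
- by move=> x _; rewrite lee_fin.
by apply: lte_add_pinfty; [exact: ltry|exact: lte_add_pinfty].
Qed.

(** The residual is split into Y - q and -P X, so the two marginal laws suffice and the joint law
    never enters. *)
Lemma integral_qform_residual_lty (R : realType) n m d (Om : measurableType d)
    (Pr : probability Om R) (X : {RV Pr >-> 'cV[R]_n}) (Y : {RV Pr >-> 'cV[R]_m})
    mu Sig nu St (M : 'M[R]_m) (P : 'M[R]_(m, n)) (q : 'cV[R]_m) :
  posdefmx Sig -> posdefmx St -> posdefmx M ->
  same_law (distribution Pr X) (gaussian mu Sig) ->
  same_law (distribution Pr Y) (gaussian nu St) ->
  (\int[Pr]_om (qform M (Y om - (P *m X om + q)))%:E < +oo)%E.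
Proof.
move=> Sigpd Stpd Mpd XL YL.
have M0 v : 0 <= qform M v by exact: qform_ge0.
have PMP v : 0 <= qform (P^T *m M *m P) v by rewrite -qform_mulmx.
have mX := measurable_funPT X; have mY := measurable_funPT Y.
pose s om := 2 * qform M (Y om - q).
pose t om := 2 * qform (P^T *m M *m P) (X om - 0).
have ms : measurable_fun setT s.
  apply: measurable_funM => //; apply: measurable_qform.
  exact: (measurableT_comp (measurable_colvec_addr _) mY).
have mt : measurable_fun setT t.
  apply: measurable_funM => //; apply: measurable_qform.
  exact: (measurableT_comp (measurable_colvec_addr _) mX).
have mr : measurable_fun setT (fun om => qform M (Y om - (P *m X om + q))).
  apply: measurable_qform; apply: measurable_colvecD => //; apply: measurable_colvecN.
  by apply: measurable_colvecD => //; exact: measurable_mulmx.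
have s0 om : 0 <= s om by rewrite mulr_ge0.
have t0 om : 0 <= t om by rewrite mulr_ge0.
have s_lty : (\int[Pr]_om (s om)%:E < +oo)%E.
  under eq_integral do rewrite EFinM.
  rewrite ge0_integralZl_EFin//.
  - by rewrite lte_mul_pinfty ?lee_fin//; exact: integral_gaussian_law_qform_lty YL.
  - by move=> om _; rewrite lee_fin.
  - apply/measurable_EFinP; apply: measurable_qform.
    exact: (measurableT_comp (measurable_colvec_addr _) mY).
have t_lty : (\int[Pr]_om (t om)%:E < +oo)%E.
  under eq_integral do rewrite EFinM.
  rewrite ge0_integralZl_EFin//.
  - by rewrite lte_mul_pinfty ?lee_fin//; exact: integral_gaussian_law_qform_lty XL.
  - by move=> om _; rewrite lee_fin.
  - apply/measurable_EFinP; apply: measurable_qform.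
    exact: (measurableT_comp (measurable_colvec_addr _) mX).
have := integral_abs_lty mr ms mt (lexx 0) s0 t0 _ s_lty t_lty.
under eq_integral do rewrite abse_EFin ger0_norm//; apply=> om.
rewrite ger0_norm// add0r /s /t subr0 -qform_mulmx.
have E : qform M (- (P *m X om)) = qform M (P *m X om).
  by rewrite /qform [(- _)^T]linearN /= !mulNmx mulmxN opprK.
rewrite -E; have := qformD_le (Y om - q) (- (P *m X om)) Mpd.
by rewrite opprD (addrC (- (P *m X om))) addrA.
Qed.

(** * Averaged relative entropy of a Gaussian kernel *)

Section gaussian_kernel_KL.
Local Open Scope ereal_scope.
Context {R : realType} (n m : nat) d (Om : measurableType d) (Pr : probability Om R).
Variables (X : {RV Pr >-> 'cV[R]_n}) (Y : {RV Pr >-> 'cV[R]_m}).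
Variables (mu : 'cV[R]_n) (Sig : 'M[R]_n) (S : 'M[R]_m) (P : 'M[R]_(m, n))
  (q : 'cV[R]_m) (k : R.-pker 'cV[R]_n ~> 'cV[R]_m).
Hypotheses (Sigpd : posdefmx Sig) (Spd : posdefmx S)
  (XL : same_law (distribution Pr X) (gaussian mu Sig))
  (kE : forall x, same_law (k x) (gaussian (P *m x + q) S))
  (XY : has_cond_density X Y (lebesgue_colvec m)
    (fun z => gaussian_pdf (P *m z.1 + q) S z.2)).

Let St := (S + P *m Sig *m P^T)%R.
Let nu := (P *m mu + q)%R.
Let g (z : 'cV[R]_n * 'cV[R]_m) := gaussian_pdf (P *m z.1 + q) S z.2.
Let gs := gaussian_pdf nu St.
Let kappa (x : 'cV[R]_n) : probability 'cV[R]_m R := pker_at k x.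
Let r : probability 'cV[R]_m R := distribution Pr Y.

Let Stpd : posdefmx St. Proof. exact: posdefmxD_congr. Qed.

Let YL : same_law (distribution Pr Y) (gaussian nu St).
Proof. exact: gaussian_law_marginal XL XY. Qed.

Let mg : measurable_fun setT g.
Proof.
apply: measurable_gaussian_pdf => //; apply: measurable_colvecD => //.
exact: measurable_mulmx.
Qed.

Let g0 z : (0 < g z)%R. Proof. exact: gaussian_pdf_gt0. Qed.

Let mgx x : measurable_fun setT (fun u => g (x, u)).
Proof. exact: (measurableT_comp mg (measurable_pair1 x)). Qed.

Let kappa_integral x (f : 'cV[R]_m -> \bar R) :
  measurable_fun setT f -> (forall u, 0 <= f u) ->
  \int[kappa x]_u f u = \int[lebesgue_colvec m]_u (f u * (g (x, u))%:E).
Proof.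
have kd : has_density (kappa x) (lebesgue_colvec m) (fun u => g (x, u)) := @kE x.
exact: (ge0_integral_density (mgx x) (fun u => ltW (g0 (x, u))) kd).
Qed.

Let joint (f : 'cV[R]_n * 'cV[R]_m -> \bar R) :
  measurable_fun setT f -> (forall z, 0 <= f z) ->
  \int[Pr]_om \int[kappa (X om)]_u f (X om, u) = \int[Pr]_om f (X om, Y om).
Proof.
move=> mf f0; rewrite (integral_cond_density mg (fun z => ltW (g0 z)) XY mf f0).
apply: eq_integral => om _; rewrite kappa_integral//.
exact: (measurableT_comp mf (measurable_pair1 (X om))).
Qed.

Let mixture (f : 'cV[R]_m -> \bar R) :
  measurable_fun setT f -> (forall u, 0 <= f u) ->
  \int[Pr]_om \int[kappa (X om)]_u f u = \int[r]_u f u.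
Proof.
move=> mf f0; rewrite (joint (f := fun z => f z.2))//; last exact: measurableT_comp.
by rewrite ge0_integral_distribution.
Qed.

Let Q1 x u := qform (invmx S) (u - (P *m x + q))%R.
Let Q2 u := qform (invmx St) (u - nu)%R.
Let a x u : R := (ln (g (x, u)) - ln (gs u))%R.
Let K := `|ln (gaussian_const St) - ln (gaussian_const S)|%R.

Let Q10 x u : (0 <= Q1 x u)%R. Proof. exact/qform_ge0/posdefmx_inv. Qed.
Let Q20 u : (0 <= Q2 u)%R. Proof. exact/qform_ge0/posdefmx_inv. Qed.

(** The log-ratio of two Gaussian densities is a constant plus half the difference of two quadratic
    forms. *)
Let a_le x u : (`|a x u| <= K + (Q1 x u + Q2 u))%R.
Proof.
rewrite /a /g /gs (ln_gaussian_pdf _ _ Spd) (ln_gaussian_pdf _ _ Stpd).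
rewrite -/(Q1 x u) -/(Q2 u).
have := Q10 x u; have := Q20 u; move: (Q1 x u) (Q2 u) => s t s0 t0.
rewrite /K; move: (ln _) (ln _) => b c.
have [? ?] : (b - c <= `|b - c| /\ c - b <= `|b - c|)%R.
  by split; [exact: ler_norm|rewrite distrC ler_norm].
rewrite ler_norml; apply/andP; split; lra.
Qed.

Let mQ1 : measurable_fun setT (fun z : 'cV[R]_n * 'cV[R]_m => Q1 z.1 z.2).
Proof.
apply: measurable_qform; apply: measurable_colvecD => //; apply: measurable_colvecN.
by apply: measurable_colvecD => //; exact: measurable_mulmx.
Qed.

Let mQ2 : measurable_fun setT Q2.
Proof. by apply: measurable_qform; exact: measurable_colvec_addr. Qed.

Let ma : measurable_fun setT (fun z => a z.1 z.2).
Proof.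
apply: measurable_funB.
  rewrite (_ : (fun z => _) = @ln R \o g); last by apply/funext => -[].
  exact: measurableT_comp (@measurable_ln R) mg.
have mlgs : measurable_fun setT (@ln R \o gs).
  exact: measurableT_comp (@measurable_ln R) (measurable_gaussian_pdfr nu St).
exact: measurableT_comp mlgs measurable_snd.
Qed.

Let K0 : (0 <= K)%R. Proof. exact: normr_ge0. Qed.

Let kappa_a_integrable x : (kappa x).-integrable setT (EFin \o a x).
Proof.
have max : measurable_fun setT (a x) := measurableT_comp ma (measurable_pair1 x).
have mq1 : measurable_fun setT (Q1 x) := measurableT_comp mQ1 (measurable_pair1 x).
have mq1E : measurable_fun setT (EFin \o Q1 x) by exact/measurable_EFinP.
have mq2E : measurable_fun setT (EFin \o Q2) by exact/measurable_EFinP.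
have q1E u : 0 <= (EFin \o Q1 x) u by rewrite lee_fin; exact: Q10.
have q2E u : 0 <= (EFin \o Q2) u by rewrite lee_fin; exact: Q20.
apply/integrableP; split; first exact/measurable_EFinP.
apply: (integral_abs_lty max mq1 mQ2 K0 (Q10 x) Q20 (a_le x)).
- rewrite (kappa_integral x mq1E q1E).
  exact: (integral_qform_gaussian_lty (P *m x + q) (P *m x + q) Spd
    (fun v => qform_ge0 v (posdefmx_inv Spd))).
- rewrite (kappa_integral x mq2E q2E).
  exact: (integral_qform_gaussian_lty (P *m x + q) nu Spd
    (fun v => qform_ge0 v (posdefmx_inv Stpd))).
Qed.

(** Averaging over state and kernel is taking the expectation at (X, Y): [Q1] becomes the policy
    residual and [Q2] the deviation of [Y] from its own mean. *)
Let joint_a_lty : \int[Pr]_om \int[kappa (X om)]_u `|(a (X om) u)%:E| < +oo.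
Proof.
have mX := measurable_funPT X; have mY := measurable_funPT Y.
have mXY : measurable_fun setT (fun om => (X om, Y om)).
  by apply/measurable_fun_pairP; split.
have maE : measurable_fun setT (fun z => `|(a z.1 z.2)%:E|).
  have maE0 : measurable_fun setT (EFin \o fun z => a z.1 z.2) by exact/measurable_EFinP.
  by apply: (measurableT_comp _ maE0).
rewrite (joint maE (fun z => abse_ge0 _)).
apply: (integral_abs_lty (measurableT_comp ma mXY) (measurableT_comp mQ1 mXY)
  (measurableT_comp mQ2 mY) K0 (fun om => Q10 _ _) (fun om => Q20 _) (fun om => a_le _ _)).
  exact: (integral_qform_residual_lty _ _ Sigpd Stpd (posdefmx_inv Spd) XL YL).
exact: (integral_gaussian_law_qform_lty nu Stpd
  (fun v => qform_ge0 v (posdefmx_inv Stpd)) YL).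
Qed.

Lemma gaussian_kernel_KL_min :
  [/\ forall p : probability 'cV[R]_m R,
        measurable_fun setT (fun om => KL (pker_at k (X om)) p),
      \int[Pr]_om KL (pker_at k (X om)) (distribution Pr Y) < +oo,
      forall p : probability 'cV[R]_m R,
        \int[Pr]_om KL (pker_at k (X om)) (distribution Pr Y) <=
        \int[Pr]_om KL (pker_at k (X om)) p
    & forall p : probability 'cV[R]_m R,
        \int[Pr]_om KL (pker_at k (X om)) p =
        \int[Pr]_om KL (pker_at k (X om)) (distribution Pr Y) ->
        same_law p (distribution Pr Y)].
Proof.
have mX := measurable_funPT X.
have mgs : measurable_fun setT gs by exact: measurable_gaussian_pdfr.
have gs0 u : (0 < gs u)%R by exact: gaussian_pdf_gt0.
have kd x : has_density (kappa x) (lebesgue_colvec m) (fun u => g (x, u)) := @kE x.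
have rd : has_density r (lebesgue_colvec m) gs := YL.
split.
- exact: (measurable_KL_mixture mX mg g0 mgs gs0 kd rd).
- exact: (integral_KL_mixture_lty mX mg g0 mgs gs0 kd rd joint_a_lty).
- exact: (integral_KL_mixture_min mX mg g0 mgs gs0 kd rd mixture kappa_a_integrable).
- exact: (integral_KL_mixture_eq mX mg g0 mgs gs0 kd rd mixture kappa_a_integrable
    joint_a_lty).
Qed.

End gaussian_kernel_KL.

(** * Decomposition of the cost and conclusion *)

Lemma wnorm_sqr (R : realType) n (M : 'M[R]_n) v :
  posdefmx M -> wnorm M v ^+ 2 = qform M v.
Proof. by move=> Mpd; rewrite sqr_sqrtr//; exact: qform_ge0. Qed.

Lemma mule_EFin_inj (R : realType) (e : R) (s t : \bar R) :
  0 < e -> (e%:E * s = e%:E * t)%E -> s = t.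
Proof.
move=> e0 /(congr1 (fun z => (e^-1)%:E * z)%E).
by rewrite !muleA -EFinM mulVf ?gt_eqF// !mul1e.
Qed.

(** One strict inequality among the terms would make the sums strictly ordered, the smaller terms
    being finite. This passes from optimality of the whole family of priors to each stage. *)
Lemma sume_squeeze (R : realType) (I : finType) (a b : I -> \bar R) :
  (forall i, a i \is a fin_num) -> (forall i, a i <= b i)%E ->
  (\sum_i b i <= \sum_i a i)%E -> forall i, b i = a i.
Proof.
move=> afin ab ba i; apply/eqP; rewrite eq_le ab andbT leNgt; apply/negP => abi.
move: ba; rewrite (bigD1 i)//= [leRHS](bigD1 i)//= leNgt => /negP; apply.
rewrite lte_leD//; first by rewrite sum_fin_num;
  apply/allP => _ /mapP[j _ ->]; exact: afin.
by apply: lee_sum.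
Qed.

Lemma integral_half_qform_fin (R : realType) n d (Om : measurableType d)
    (Pr : probability Om R) (X : {RV Pr >-> 'cV[R]_n}) mu Sig (M : 'M[R]_n) c :
  posdefmx Sig -> posdefmx M -> same_law (distribution Pr X) (gaussian mu Sig) ->
  (\int[Pr]_om (2^-1 * qform M (X om - c))%:E)%E \is a fin_num.
Proof.
move=> Spd Mpd XL; have M0 v : 0 <= qform M v by exact: qform_ge0.
rewrite ge0_fin_numE; last first.
  by apply: integral_ge0 => om _; rewrite lee_fin mulr_ge0.
under eq_integral do rewrite EFinM.
rewrite ge0_integralZl_EFin//.
- by rewrite lte_mul_pinfty ?lee_fin//; exact: integral_gaussian_law_qform_lty XL.
- by move=> om _; rewrite lee_fin.
- apply/measurable_EFinP; apply: measurable_qform.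
  exact: (measurableT_comp (measurable_colvec_addr _) (measurable_funPT X)).
Qed.

Section cost.
Context {R : realType} (T n m : nat) (eps : R) (mu_fin : 'cV[R]_n).
Variables (Rc : 'I_T -> 'M[R]_m) (F : 'M[R]_n).
Context d (Omega : measurableType d) (Pr : probability Omega R).
Variables (x : nat -> {RV Pr >-> 'cV[R]_n}) (u : 'I_T -> {RV Pr >-> 'cV[R]_m}).
Variable pi : 'I_T -> R.-pker 'cV[R]_n ~> 'cV[R]_m.
Hypotheses (heps : 0 < eps) (hRc : forall k, posdefmx (Rc k)) (hF : posdefmx F).
Hypothesis mKL : forall (k : 'I_T) (p : probability 'cV[R]_m R),
  measurable_fun setT (fun om => KL (pker_at (pi k) (x k om)) p).
Local Open Scope ereal_scope.

(** Every summand is nonnegative and measurable, so the expectation distributes in [0, +oo]. Only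
    the divergence integrals then involve [rho], one component each. *)
Lemma costE (rho : 'I_T -> probability 'cV[R]_m R) :
  cost eps mu_fin Rc F x u pi rho =
  \sum_(k < T) (\int[Pr]_om (2^-1 * qform (Rc k) (u k om))%:E +
    eps%:E * \int[Pr]_om KL (pker_at (pi k) (x k om)) (rho k)) +
  \int[Pr]_om (2^-1 * qform F (x T om - mu_fin))%:E.
Proof.
have m1 k : measurable_fun setT (fun om => (2^-1 * qform (Rc k) (u k om))%:E).
  apply/measurable_EFinP; apply: measurable_funM => //.
  by apply: measurable_qform; exact: measurable_funPT.
have m2 : measurable_fun setT (fun om => (2^-1 * qform F (x T om - mu_fin))%:E).
  apply/measurable_EFinP; apply: measurable_funM => //; apply: measurable_qform.
  exact: (measurableT_comp (measurable_colvec_addr _) (measurable_funPT (x T))).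
have p1 k om : 0 <= (2^-1 * qform (Rc k) (u k om))%:E.
  by rewrite lee_fin mulr_ge0// qform_ge0.
have p2 k om : 0 <= eps%:E * KL (pker_at (pi k) (x k om)) (rho k).
  by rewrite mule_ge0 ?KL_ge0// lee_fin ltW.
have m3 k : measurable_fun setT (fun om => eps%:E * KL (pker_at (pi k) (x k om)) (rho k)).
  exact: measurable_funeM.
rewrite /cost; under eq_integral do rewrite (wnorm_sqr _ hF).
rewrite ge0_integralD//.
- congr (_ + _); rewrite ge0_integral_sum//.
  + apply: eq_bigr => k _; under eq_integral do rewrite (wnorm_sqr _ (hRc k)).
    rewrite ge0_integralD//; congr (_ + _); rewrite ge0_integralZl_EFin// ?ltW//.
    by move=> om _; exact: KL_ge0.
  + move=> k; under eq_fun do rewrite (wnorm_sqr _ (hRc k)).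
    exact: emeasurable_funD.
  + by move=> k om _; rewrite (wnorm_sqr _ (hRc k)) adde_ge0.
- by move=> om _; apply: sume_ge0 => k _; rewrite (wnorm_sqr _ (hRc k)) adde_ge0.
- apply: emeasurable_sum => k; under eq_fun do rewrite (wnorm_sqr _ (hRc k)).
  exact: emeasurable_funD.
- by move=> om _; rewrite lee_fin mulr_ge0// qform_ge0.
Qed.

End cost.

Theorem theorem7 (R : realType) (T n m : nat)
    (hT : (1 <= T)%N) (hn : (1 <= n)%N) (hm : (1 <= m)%N)
    (eps : R) (heps : 0 < eps)
    (mu_ini mu_fin : 'cV[R]_n) (Sigma_ini F : 'M[R]_n)
    (A : 'I_T -> 'M[R]_n) (B : 'I_T -> 'M[R]_(n, m))
    (Rc : 'I_T -> 'M[R]_m) (Sigma_w : 'I_T -> 'M[R]_n)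
    (hRc : forall k, posdefmx (Rc k)) (hF : posdefmx F)
    (hSigma_w : forall k, posdefmx (Sigma_w k)) (hSigma_ini : posdefmx Sigma_ini)
    (P : 'I_T -> 'M[R]_(m, n)) (q : 'I_T -> 'cV[R]_m) (Sigma_pi : 'I_T -> 'M[R]_m)
    (hSigma_pi : forall k, posdefmx (Sigma_pi k))
    (pi : 'I_T -> R.-pker 'cV[R]_n ~> 'cV[R]_m)
    (hpi : forall k x, same_law (pi k x) (gaussian (P k *m x + q k) (Sigma_pi k)))
    (mu_x : nat -> 'cV[R]_n) (Sigma_x : nat -> 'M[R]_n)
    (hmu0 : mu_x 0%N = mu_ini)
    (hmuS : forall k : 'I_T, mu_x k.+1 = (A k + B k *m P k) *m mu_x k + B k *m q k)
    (hSigma0 : Sigma_x 0%N = Sigma_ini)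
    (hSigmaS : forall k : 'I_T,
       Sigma_x k.+1 = (A k + B k *m P k) *m Sigma_x k *m (A k + B k *m P k)^T
                      + B k *m Sigma_pi k *m (B k)^T + Sigma_w k)
    (d : measure_display) (Omega : measurableType d) (Pr : probability Omega R)
    (x : nat -> {RV Pr >-> 'cV[R]_n}) (u : 'I_T -> {RV Pr >-> 'cV[R]_m})
    (w : 'I_T -> {RV Pr >-> 'cV[R]_n})
    (hcl : closed_loop mu_ini Sigma_ini A B Sigma_w x u w pi) :
  exists rho : 'I_T -> probability 'cV[R]_m R,
    [/\ optimal_prior eps mu_fin Rc F x u pi rho,
        forall rho', optimal_prior eps mu_fin Rc F x u pi rho' ->
          forall k, same_law (rho' k) (rho k)
      & forall k, same_law (rho k)
          (gaussian (P k *m mu_x k + q k)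
                    (Sigma_pi k + P k *m Sigma_x k *m (P k)^T))].
Proof.
have state k := closed_loop_state_law hSigma_w hSigma_ini hSigma_pi hpi hmu0 hmuS
  hSigma0 hSigmaS hcl (k := k).
have input k := closed_loop_input_law hSigma_w hSigma_ini hSigma_pi hpi hmu0 hmuS
  hSigma0 hSigmaS hcl k.
have KLmin (k : 'I_T) := gaussian_kernel_KL_min (state k (ltnW (ltn_ord k))).1
  (hSigma_pi k) (state k (ltnW (ltn_ord k))).2 (hpi k)
  (closed_loop_input_density hpi hcl k).
have mKL k p : measurable_fun setT (fun om => KL (pker_at (pi k) (x k om)) p).
  by have [mKL _ _ _] := KLmin k; exact: mKL.
(* The witness is the law of the input, a probability by construction; that it is the announced
   Gaussian is [input]. *)
pose rho (k : 'I_T) : probability 'cV[R]_m R := distribution Pr (u k).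
have costE' := costE mu_fin u heps hRc hF mKL.
have KL_le rho' j : (\int[Pr]_om (2^-1 * qform (Rc j) (u j om))%:E +
    eps%:E * \int[Pr]_om KL (pker_at (pi j) (x j om)) (rho j) <=
    \int[Pr]_om (2^-1 * qform (Rc j) (u j om))%:E +
    eps%:E * \int[Pr]_om KL (pker_at (pi j) (x j om)) (rho' j))%E.
  have [_ _ KLle _] := KLmin j; apply: leeD2l; apply: lee_wpmul2l (KLle _).
  by rewrite lee_fin ltW.
exists rho; split; last exact: input.
  by move=> rho'; rewrite !costE'; apply: leeD2r; apply: lee_sum => k _; exact: KL_le.
(* The terminal cost, common to both sides, is finite and cancels. *)
move=> rho' /(_ rho); rewrite !costE' leeD2rE; last first.
  have [Spd SL] := state T (leqnn T).
  exact: (integral_half_qform_fin _ Spd hF SL).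
move=> le_sum k.
have [_ _ _ KLeq] := KLmin k; apply: KLeq.
have Ifin j : (\int[Pr]_om KL (pker_at (pi j) (x j om)) (rho j))%E \is a fin_num.
  have [_ Ilty _ _] := KLmin j; rewrite ge0_fin_numE; first exact: Ilty.
  by apply: integral_ge0 => om _; exact: KL_ge0.
have Cfin j : (\int[Pr]_om (2^-1 * qform (Rc j) (u j om))%:E)%E \is a fin_num.
  (* The input cost is viewed as a deviation from the centre 0. *)
  under eq_integral do rewrite -(subr0 (u j _)).
  have [Spd _] := state j (ltnW (ltn_ord j)).
  exact: (integral_half_qform_fin _ (posdefmxD_congr (P j) (hSigma_pi j) Spd) (hRc j) (input j)).
have afin j : (\int[Pr]_om (2^-1 * qform (Rc j) (u j om))%:E +
    eps%:E * \int[Pr]_om KL (pker_at (pi j) (x j om)) (rho j))%E \is a fin_num.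
  by rewrite fin_numD Cfin fin_numM.
have := sume_squeeze afin (KL_le rho') le_sum k.
move=> /(adde_fin_inj (Cfin k)); exact: mule_EFin_inj.
Qed.
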